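(* Let $H$ be an $R$-Hopf order in $K[C_p^3]$, and let $$R\to E(i_1,i_2,\mu)\to H\to E(i_3)\to R$$ be the short exact sequence of $R$-Hopf orders induced by $H$, where $i_1,i_2,i_3\ge 0$ are integers and $\mu\in K$ satisfies $\nu(\wp(\mu))\ge i_2-pi_1$. Assume that $\nu(\mu)\ge i_3-i_1$ and $i_2\ge i_3$. Then $$H=R\left [\frac{g_1-1}{\pi^{i_1}},\ \frac{g_2g_1^{[\mu]}-1}{\pi^{i_2}},\ \frac{g_3g_1^{[\alpha]}(g_2g_1^{[\mu]})^{[\beta]}-1}{\pi^{i_3}}\right ]$$ for some elements $\alpha,\beta$ of $K$ satisfying $\nu(\wp(\alpha)+\wp(\mu)\beta)\ge i_3-pi_1$ and $\nu(\wp(\beta))\ge i_3-pi_2$.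
   Context: Let $p$ be a prime and let $K$ be a field of characteristic $p$ that is complete with respect to a discrete valuation $\nu:K\to\mathbb{Z}\cup\{\infty\}$ with uniformizing parameter $\pi$, $\nu(\pi)=1$. Let $R=\{x\in K\mid \nu(x)\ge 0\}$. For $x\in K$ put $\wp(x)=x^p-x$. The truncated exponential is $x^{[y]}=\sum_{m=0}^{p-1}\binom{y}{m}(x-1)^m$, where $\binom{y}{m}=y(y-1)\cdots(y-m+1)/m!$. For a finite dimensional $K$-Hopf algebra $B$, an $R$-Hopf order in $B$ is an $R$-Hopf algebra $H$ which is a finitely generated projective (hence free) $R$-submodule of $B$ with $K\otimes_R H\cong B$ as $K$-Hopf algebras; the comultiplication, counit and coinverse of $H$ are those induced from $B$. $C_p^3=\langle g_1,g_2,g_3\rangle$ is the elementary abelian group of order $p^3$. $R[\ldots]$ denotes the $R$-subalgebra generated by the indicated elements. $E(i_1,i_2,\mu)=R\left[\frac{g_1-1}{\pi^{i_1}},\frac{g_2g_1^{[\mu]}-1}{\pi^{i_2}}\right]$ is a Hopf order in $K[\langle g_1,g_2\rangle]=K[C_p^2]$, and $E(i_3)=R\left[\frac{\bar g_3-1}{\pi^{i_3}}\right]$ is a Hopf order in $K[C_p]$, where $C_p=\langle \bar g_3\rangle=C_p^3/\langle g_1,g_2\rangle$. The short exact sequence induced by $H$ is the one whose maps are restrictions of the inclusion $K[\langle g_1,g_2\rangle]\to K[C_p^3]$ and of the projection $K[C_p^3]\to K[C_p^3/\langle g_1,g_2\rangle]$, so its first term is $H\cap K[\langle g_1,g_2\rangle]$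 and its last term is the image of $H$. By known classification results for Hopf orders in $K[C_p^2]$ and $K[C_p]$ these terms have the indicated form for some $i_1,i_2,i_3\ge 0$ and $\mu\in K$ with $\nu(\wp(\mu))\ge i_2-pi_1$. *)

(* Defs.v *)
From HB Require Import structures.
From mathcomp Require Import all_boot all_order all_algebra all_fingroup all_solvable.
From mathcomp Require Import classical_sets constructive_ereal.
Set Implicit Arguments.
Unset Strict Implicit.
Unset Printing Implicit Defensive.
Import Order.TTheory GRing.Theory Num.Theory.
Local Open Scope ring_scope.

(* The group algebra K[G] of the whole group G = [set: gT]: functions G -> K   *)
(* under convolution.  It is an alias, because {ffun gT -> K} already carries  *)
(* the pointwise product.                                                      *)
Definition galg (K : fieldType) (gT : finGroupType) : Type := {ffun gT -> K^o}.

Section GroupAlgebra.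
Variables (K : fieldType) (gT : finGroupType).
Local Notation B := (galg K gT).

HB.instance Definition _ := GRing.Lmodule.on B.

Definition gr (g : gT) : B := [ffun x => (x == g)%:R].

Definition galg_mul (a b : B) : B :=
  [ffun x => \sum_(y : gT) a y * b (y^-1 * x)%g].

Fact galg_mulA : associative galg_mul.
Proof.
move=> a b c; apply/ffunP => x; rewrite !ffunE.
under eq_bigr => y _ do rewrite ffunE big_distrr /=.
under [RHS]eq_bigr => y _ do rewrite ffunE big_distrl /=.
rewrite [RHS]exchange_big /=; apply: eq_bigr => y _.
rewrite [RHS](reindex_inj (mulgI y)) /=; apply: eq_bigr => z _.
by rewrite mulKg invMg !mulgA mulrA.
Qed.

Fact galg_mul1l : left_id (gr 1%g) galg_mul.
Proof.
move=> a; apply/ffunP => x; rewrite ffunE (bigD1 1%g) //= big1 ?addr0.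
  by rewrite ffunE eqxx mul1r invg1 mul1g.
by move=> y /negPf y1; rewrite ffunE y1 mul0r.
Qed.

Fact galg_mul1r : right_id (gr 1%g) galg_mul.
Proof.
move=> a; apply/ffunP => x; rewrite ffunE (bigD1 x) //= big1 ?addr0.
  by rewrite ffunE mulVg eqxx mulr1.
by move=> y yx; rewrite ffunE -eq_mulVg1 (negPf yx) mulr0.
Qed.

Fact galg_mulDl : left_distributive galg_mul +%R.
Proof.
move=> a b c; apply/ffunP => x; rewrite !ffunE -big_split /=.
by apply: eq_bigr => y _; rewrite ffunE mulrDl.
Qed.

Fact galg_mulDr : right_distributive galg_mul +%R.
Proof.
move=> a b c; apply/ffunP => x; rewrite !ffunE -big_split /=.
by apply: eq_bigr => y _; rewrite ffunE mulrDr.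
Qed.

Fact galg_1neq0 : gr 1%g != 0.
Proof.
by apply/eqP => /ffunP/(_ 1%g)/eqP; rewrite !ffunE eqxx oner_eq0.
Qed.

HB.instance Definition _ := GRing.Zmodule_isNzRing.Build B
  galg_mulA galg_mul1l galg_mul1r galg_mulDl galg_mulDr galg_1neq0.

Fact galg_scaleAl (c : K) (a b : B) : c *: (a * b) = (c *: a) * b.
Proof.
apply/ffunP => x; rewrite !ffunE scaler_sumr; apply: eq_bigr => y _.
by rewrite ffunE scalerAl.
Qed.
HB.instance Definition _ := GRing.Lmodule_isLalgebra.Build K B galg_scaleAl.

Fact galg_scaleAr (c : K) (a b : B) : c *: (a * b) = a * (c *: b).
Proof.
apply/ffunP => x; rewrite !ffunE scaler_sumr; apply: eq_bigr => y _.
by rewrite ffunE scalerAr.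
Qed.
HB.instance Definition _ := GRing.Lalgebra_isAlgebra.Build K B galg_scaleAr.

Lemma gr1 : gr 1%g = 1. Proof. by []. Qed.

Lemma grM (g h : gT) : gr (g * h)%g = gr g * gr h.
Proof.
apply/ffunP => x; rewrite !ffunE (bigD1 g) //= big1 ?addr0.
  by rewrite !ffunE eqxx mul1r (can2_eq (mulKVg g) (mulKg g)).
by move=> y /negPf yg; rewrite ffunE yg mul0r.
Qed.

Lemma galgE (a : B) : a = \sum_(g : gT) a g *: gr g.
Proof.
apply/ffunP => x; rewrite sum_ffunE (bigD1 x) //= big1 ?addr0.
  by rewrite !ffunE eqxx [_ *: _]mulr1.
by move=> y yx; rewrite !ffunE eq_sym (negPf yx) [_ *: _]mulr0.
Qed.

Definition counit (a : B) : K := \sum_(g : gT) a g.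

Definition coinv (a : B) : B := \sum_(g : gT) a g *: gr g^-1%g.

End GroupAlgebra.

Section Maps.
Variables (K : fieldType) (gT hT : finGroupType).

(* K[f] : K[G] -> K[G'], the linear extension of f. *)
Definition galg_map (f : gT -> hT) (a : galg K gT) : galg K hT :=
  \sum_(g : gT) a g *: gr K (f g).

(* K[G] (x) K[G'] is identified with K[G x G'], g (x) g' being (g, g'). *)
Definition tens (a : galg K gT) (b : galg K hT) : galg K (gT * hT)%type :=
  [ffun xy => a xy.1 * b xy.2].

End Maps.

(* K[N] inside K[G], for N a subgroup of G. *)
Definition galg_sub (K : fieldType) (gT : finGroupType) (N : {set gT}) :
    set (galg K gT) :=
  [set a | forall g, g \notin N -> a g = 0]%classic.
Arguments galg_sub K {gT} N.

Definition comult (K : fieldType) (gT : finGroupType) (a : galg K gT) :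
  galg K (gT * gT)%type := galg_map (fun g => (g, g)) a.

(* Valuations take values in \bar int; -oo is excluded by the axioms. *)
Section Valuation.
Variables (K : fieldType) (v : K -> \bar int).

Definition discrete_valuation : Prop :=
  [/\ forall x, v x = +oo%E <-> x = 0,
      forall x, v x <> -oo%E,
      forall x y, v (x * y) = (v x + v y)%E &
      forall x y, (Order.min (v x) (v y) <= v (x + y))%E].

Definition val_complete : Prop :=
  forall u : nat -> K,
    (forall N : int, exists n0 : nat, forall m n : nat,
       (n0 <= m)%N -> (n0 <= n)%N -> (N%:E <= v (u m - u n))%E) ->
    exists l : K, forall N : int, exists n0 : nat, forall n : nat,
       (n0 <= n)%N -> (N%:E <= v (u n - l))%E.

Local Open Scope classical_set_scope.

Definition val_ring : set K := [set x | (0 <= v x)%E].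

End Valuation.

Section Orders.
Local Open Scope classical_set_scope.
Variables (K : fieldType) (S : set K).

Definition is_submod (V : lmodType K) (M : set V) : Prop :=
  [/\ M 0, forall x y, M x -> M y -> M (x + y) &
      forall c x, S c -> M x -> M (c *: x)].

Definition lspan (V : lmodType K) (X : set V) : set V :=
  smallest (@is_submod V) X.

Definition is_subalg (A : algType K) (M : set A) : Prop :=
  [/\ is_submod M, M 1 & forall x y, M x -> M y -> M (x * y)].

Definition alg_gen (A : algType K) (X : set A) : set A :=
  smallest (@is_subalg A) X.

(* The S-submodule M is finitely generated and projective: some surjection     *)
(* S^n -> M, (c_i) |-> \sum_i c_i e_i, has an S-linear section s.              *)
Definition fg_projective (V : lmodType K) (M : set V) : Prop :=
  exists (n : nat) (e : 'I_n -> V),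
    M = lspan (range e) /\
    exists s : V -> 'I_n -> K,
      [/\ forall x i, M x -> S (s x i),
          forall x y i, M x -> M y -> s (x + y) i = s x i + s y i,
          forall c x i, S c -> M x -> s (c *: x) i = c * s x i &
          forall x, M x -> \sum_(i < n) s x i *: e i = x].

End Orders.

Section HopfOrders.
Local Open Scope classical_set_scope.
Variables (K : fieldType) (v : K -> \bar int).
Local Notation R := (val_ring v).

(* For an R-submodule H of K[G], K (x)_R H -> K[G] is injective, since H is    *)
(* torsion-free, so it is an isomorphism as soon as H spans K[G]; H being      *)
(* R-flat, H (x)_R H embeds in K[G] (x) K[G] as the R-span of the pure tensors.*)
Definition Hopf_order (gT : finGroupType) (H : set (galg K gT)) : Prop :=
  [/\ is_subalg R H,
      fg_projective R H,
      lspan [set: K] H = [set: galg K gT] &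
      [/\ forall a, H a ->
            lspan R [set t | exists a1 a2, [/\ H a1, H a2 & t = tens a1 a2]]
              (comult a),
          forall a, H a -> R (counit a) &
          forall a, H a -> H (coinv a)]].

End HopfOrders.

Section TruncatedExponential.
Variables (K : fieldType) (p : nat).

Definition wp (x : K) : K := x ^+ p - x.

Definition gbinom (y : K) (m : nat) : K :=
  (\prod_(j < m) (y - j%:R)) / (m`!)%:R.

Definition texp (A : algType K) (x : A) (y : K) : A :=
  \sum_(m < p) gbinom y m *: (x - 1) ^+ m.

End TruncatedExponential.

(* (x - 1) / pi^i *)
Definition divpi (K : fieldType) (pi : K) (i : nat) (A : algType K) (x : A) : A :=
  pi ^- i *: (x - 1).

(* Main.v *)
Require Import Defs.
From HB Require Import structures.
From mathcomp Require Import all_boot all_order all_algebra all_fingroup all_solvable.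
From mathcomp Require Import classical_sets constructive_ereal.
From mathcomp Require Import ring zify.
Import Order.TTheory GRing.Theory Num.Theory.
Local Open Scope ring_scope.

(** An additive character [f : G -> K], a morphism from [G] to the additive
group of [K], acts on [K[G]] by the derivation [D_f] that multiplies each
group element [g] by [f g].  The characters are the primitive elements of the
dual Hopf algebra, so [D_f] preserves a Hopf order [H] as soon as the
functional [counit o D_f] takes integral values on [H] ([gder_stable]).  This
turns the comultiplication of [H] into differential calculus in a commutative
ring, and the proof consists of solving first order equations in [H].

Let [chi_i] be the characters dual to [g_i], and let [D_3] be the derivation
of [pi^i3 chi_3].  Its kernel is [K[N]].  An element [T] with
[D_3 T = 1 + pi^i3 T] is the same thing as an eigenvector
[X = 1 + pi^i3 T = g_3 u] with [u] in [K[N]].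

Existence of such a [T] in [H] ([eigen_lift]).  The last term of the exact
sequence provides [h] in [H] of augmentation 0 with [counit (D_3 h) = 1].  The
product of the operators [D_3 - j pi^i3] for [0 < j < p] sends [h^(p-1)] to an
element of [H] in [K[N]] whose augmentation is [(p-1)!].  That element is
invertible in [H], because a p-th power in [K[G]] is the p-th power of the
augmentation ([cgalg_pow_p]).  Divide [h^(p-1)] by it and apply all the factors
except [D_3 - pi^i3]: the result [W] satisfies [(D_3 - pi^i3) W = 1].

Any such [T] generates [H] over the first term of the sequence
([generated_by_lift]): [D_3] is [(1 + pi^i3 T) d/dT], and a Taylor expansion at
[T = 0] subtracts from an element of [H] a multiple of [T] in [H] so as to
leave a constant ([descent], [ascent]).

It remains to move [u] to a product of truncated exponentials without leaving
[H].  Write [x1 = g_1] and [x2 = g_2 g_1^[mu]].  Let [D_1] and [D_2] be the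
derivations of [pi^i1 (chi_1 - mu chi_2) - a_1 chi_3] and
[pi^i2 chi_2 - a_2 chi_3], with [a_i] such that [counit (D_i X) = 0].  Both
preserve [H], and [D_i u = a_i u] modulo [pi^i3 H] ([log_der_unit]).  Put
[alpha = a_1 / pi^i1] and [beta = a_2 / pi^i2].  On [K[N]],
[D_2^p = pi^((p-1) i2) D_2] and
[D_1^p = pi^((p-1) i1) D_1 - pi^(p i1 - i2) wp(mu) D_2], so that applying [D_i]
to [u] [p] times yields the two valuation conditions.  By the formula for the
derivative of a truncated exponential ([der_texp]), these conditions are
exactly what makes [y = x1^[alpha] x2^[beta]] satisfy the same equations
[D_i y = a_i y] modulo [pi^i3 H].  Hence [D_1] and [D_2] kill [w = u / y] modulo
[pi^i3 H].  They behave like the partial derivatives in the two generators of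
the first term, so that [w] is 1 modulo [pi^i3 H] ([near_scalar]).  Therefore
[(g_3 y - 1) / pi^i3] lies in [H], and it generates. *)

Set Implicit Arguments.
Unset Strict Implicit.

(** * The valuation ring in characteristic p *)

Section PrimeCharacteristic.
Variables (p : nat) (K : fieldType).
Hypothesis charK : p \in [pchar K].

Lemma natf_small_neq0 k : (0 < k < p)%N -> k%:R != 0 :> K.
Proof.
move=> /andP[k0 kp]; apply/negP; rewrite -(dvdn_pcharf charK) => /(dvdn_leq k0).
by rewrite leqNgt kp.
Qed.

Lemma factf_neq0 k : (k < p)%N -> k`!%:R != 0 :> K.
Proof.
elim: k => [|k IH] kp; first by rewrite oner_eq0.
by rewrite factS natrM mulf_neq0 ?IH ?natf_small_neq0 // (ltnW kp).
Qed.

End PrimeCharacteristic.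

Section ValuationRing.
Variables (K : fieldType) (v : K -> \bar int).
Hypothesis valK : discrete_valuation v.
Local Notation R := (val_ring v).

Lemma val_finite x : x != 0 -> exists n : int, v x = n%:E.
Proof.
case: valK => v0 vN _ _ x0.
case E : (v x) => [n||]; first by exists n.
- by move/v0: E x0 => ->; rewrite eqxx.
- by case: (vN x).
Qed.

Lemma val1 : v 1 = 0%:E.
Proof.
case: valK => v0 vN vM _; have [n En] := val_finite (oner_neq0 K).
have := vM 1 1; rewrite mulr1 En -EFinD => -[/eqP].
by rewrite -subr_eq subrr eq_sym => /eqP ->.
Qed.

Lemma valN1 : v (-1) = 0%:E.
Proof.
case: valK => v0 vN vM _.
have m1 : (-1 : K) != 0 by rewrite oppr_eq0 oner_eq0.
have [n En] := val_finite m1.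
have := vM (-1) (-1); rewrite mulrNN mulr1 val1 En -EFinD => -[E].
by congr EFin; lia.
Qed.

Lemma valX x n (m : int) : v x = m%:E -> v (x ^+ n) = (m *+ n)%:E.
Proof.
case: valK => v0 vN vM _ E; elim: n => [|n IH]; first by rewrite expr0 val1.
by rewrite exprS vM IH E -EFinD mulrS.
Qed.

Lemma vringM x y : R x -> R y -> R (x * y).
Proof.
by case: valK => _ _ vM _; rewrite /val_ring /= vM => *; apply: adde_ge0.
Qed.

Lemma vringD x y : R x -> R y -> R (x + y).
Proof.
case: valK => _ _ _ vD Rx Ry; apply: le_trans (vD x y).
by rewrite le_min; apply/andP; split.
Qed.

Lemma vring1 : R 1. Proof. by rewrite /val_ring /= val1. Qed.

Lemma vring0 : R 0.
Proof.
by case: valK => v0 _ _ _; rewrite /val_ring /= (iffRL (v0 0)).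
Qed.

Lemma vringN x : R x -> R (- x).
Proof.
by move=> Rx; rewrite -mulN1r; apply: vringM => //; rewrite /val_ring /= valN1.
Qed.

Lemma vringX x n : R x -> R (x ^+ n).
Proof.
move=> Rx; elim: n => [|n IH]; [exact: vring1 | rewrite exprS; exact: vringM].
Qed.

Lemma vring_nat n : R n%:R.
Proof.
by elim: n => [|n IH]; [exact: vring0 | rewrite -addn1 natrD; apply: vringD; last exact: vring1].
Qed.

(** By Fermat a nonzero natural number is its own p-th power, hence its inverse
    is again a power of it. *)
Lemma vring_natV p n : p \in [pchar K] -> R (n%:R)^-1.
Proof.
move=> charK; have [->|n0] := eqVneq (n%:R : K) 0; first by rewrite invr0; exact: vring0.
have p1 : (1 < p)%N by apply/prime_gt1/(pcharf_prime charK).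
have np : (n%:R : K) ^+ p = n%:R by rewrite -(pFrobenius_autE charK) pFrobenius_aut_nat.
suff -> : (n%:R : K)^-1 = n%:R ^+ (p - 2) by apply: vringX; exact: vring_nat.
apply: (mulfI n0); apply: (mulfI n0).
by rewrite divff // mulr1 -!exprS -[in LHS]np; congr (_ ^+ _); lia.
Qed.

(** A negative valuation would make the powers unbounded.  This replaces the
    argument that an element of a finitely generated ring is integral. *)
Lemma vring_pow_bounded x c : c != 0 -> (forall n, R (c * x ^+ n)) -> R x.
Proof.
move=> c0 H; have [->|x0] := eqVneq x 0; first exact: vring0.
case: valK => _ _ vM _.
have [a Ea] := val_finite x0; have [b Eb] := val_finite c0.
rewrite /val_ring /= Ea lee_fin leNgt; apply/negP => a0.
have := H (`|b|.+1)%N; rewrite /val_ring /= vM (valX _ Ea) Eb -EFinD lee_fin -mulr_natr natz.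
by nia.
Qed.

Lemma val_geP pi c n m : v pi = 1%:E ->
  ((n%:Z - m%:Z)%R%:E <= v c)%E <-> R (pi ^+ m * c / pi ^+ n).
Proof.
move=> vpi; have pi0 : pi != 0.
  by apply/eqP => p0; case: valK => v0 _ _ _; move/v0: p0; rewrite vpi.
have [->|c0] := eqVneq c 0.
  rewrite mulr0 mul0r; split=> _; first exact: vring0.
  by case: valK => v0 _ _ _; rewrite (iffRL (v0 0)) ?leey.
have [a Ea] := val_finite c0; case: (valK) => _ _ vM _.
have y0 : pi ^+ m * c / pi ^+ n != 0.
  by rewrite !mulf_neq0 ?invr_eq0 ?expf_neq0.
have [b Eb] := val_finite y0.
have := vM (pi ^+ m * c / pi ^+ n) (pi ^+ n).
rewrite mulfVK ?expf_neq0 // vM !(valX _ vpi) Ea Eb -!EFinD => -[].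
rewrite /val_ring /= !Eb !lee_fin; rewrite !natz.
by split; lia.
Qed.

Lemma bounded_scale pi c : v pi = 1%:E -> exists n, R (pi ^+ n * c).
Proof.
move=> vpi; case: (valK) => v0 _ vM _.
have [->|c0] := eqVneq c 0; first by exists 0%N; rewrite mulr0; exact: vring0.
have [a Ea] := val_finite c0; exists `|a|%N.
rewrite /val_ring /= vM (valX _ vpi) Ea -EFinD lee_fin -mulr_natr mul1r natz; lia.
Qed.

End ValuationRing.

(** * Submodules and generated subalgebras *)

Section Submodules.
Variables (K : fieldType) (v : K -> \bar int).
Hypothesis valK : discrete_valuation v.
Local Notation R := (val_ring v).

Lemma submodN (V : lmodType K) (M : set V) x : is_submod R M -> M x -> M (- x).
Proof.
move=> [_ _ MZ] Mx; rewrite -scaleN1r; apply: MZ => //.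
exact/vringN/vring1.
Qed.

Lemma submodB (V : lmodType K) (M : set V) x y :
  is_submod R M -> M x -> M y -> M (x - y).
Proof. by move=> MM Mx My; case: (MM) => _ MD _; apply: MD => //; exact: submodN. Qed.

Lemma submod_sum (V : lmodType K) (M : set V) I (r : seq I) (P : pred I) F :
  is_submod R M -> (forall i, P i -> M (F i)) -> M (\sum_(i <- r | P i) F i).
Proof. by move=> [M0 MD _] MF; elim/big_ind: _. Qed.

Lemma subalgX (A : algType K) (M : set A) x n : is_subalg R M -> M x -> M (x ^+ n).
Proof.
move=> [_ M1 MM] Mx; elim: n => [//|n IH]; rewrite exprS; exact: MM.
Qed.

End Submodules.

Section Generation.
Local Open Scope classical_set_scope.
Variables (K : fieldType) (S : set K).

Lemma lspan_min (V : lmodType K) (X M : set V) : is_submod S M -> X `<=` M ->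
  lspan S X `<=` M.
Proof. exact: smallest_sub. Qed.

Lemma mem_lspan (V : lmodType K) (X : set V) : X `<=` lspan S X.
Proof. exact: sub_smallest. Qed.

Lemma alg_gen_min (A : algType K) (X M : set A) : is_subalg S M -> X `<=` M ->
  alg_gen S X `<=` M.
Proof. exact: smallest_sub. Qed.

Lemma mem_alg_gen (A : algType K) (X : set A) : X `<=` alg_gen S X.
Proof. exact: sub_smallest. Qed.

Lemma alg_gen_subalg (A : algType K) (X : set A) : is_subalg S (alg_gen S X).
Proof.
split; [split | |].
- by move=> M [[[]]].
- by move=> x y Hx Hy M MX; case: (MX) => [[[_ MD _] _ _] _]; apply: MD; [exact: Hx|exact: Hy].
- by move=> c x Sc Hx M MX; case: (MX) => [[[_ _ MZ] _ _] _]; apply: MZ => //; exact: Hx.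
- by move=> M [[]].
- by move=> x y Hx Hy M MX; case: (MX) => [[_ _ MM] _]; apply: MM; [exact: Hx|exact: Hy].
Qed.

End Generation.

(** * Derivations of commutative algebras *)

Section Derivations.
Variables (K : fieldType) (A : comAlgType K) (D : {linear A -> A}).
Hypothesis DM : forall a b, D (a * b) = D a * b + a * D b.

Lemma der1 : D 1 = 0.
Proof. by have /eqP := DM 1 1; rewrite !mulr1 mul1r -subr_eq0 opprD addNKr oppr_eq0 => /eqP. Qed.

Lemma der_exp x n : D (x ^+ n) = (x ^+ n.-1 * D x) *+ n.
Proof.
case: n => [|n]; first by rewrite expr0 der1.
elim: n => [|n IH]; first by rewrite !expr1 expr0 mul1r.
by rewrite exprS DM IH /= mulrnAr mulrA -exprS mulrC -mulrS.
Qed.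

(** The polynomial in [D] with roots [c 0, ..., c (k - 1)]; the factors commute,
    and the recursion applies [D - c (k - 1)] last. *)
Fixpoint shifts (c : nat -> K) (k : nat) (a : A) : A :=
  if k is j.+1 then D (shifts c j a) - c j *: shifts c j a else a.

Lemma shiftsSr c k a :
  shifts c k.+1 a = shifts (c \o succn) k (D a - c 0%N *: a).
Proof. by elim: k => //= k <-. Qed.

Lemma shiftsMl c k a b : D b = 0 -> shifts c k (b * a) = b * shifts c k a.
Proof.
by move=> Db; elim: k => //= k ->; rewrite DM Db mul0r add0r scalerAr -mulrBr.
Qed.

(** Only the term in which each of the [k] operators differentiates one of the
    [k] factors [h] survives the augmentation. *)
Lemma shifts_aug (e : {rmorphism A -> K}) c k h y :
    (forall x a, e (x *: a) = x * e a) -> e h = 0 ->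
  e (shifts c k (h ^+ k * y)) = k`!%:R * e (D h) ^+ k * e y.
Proof.
move=> eZ eh.
elim: k c y => [|k IH] c y; first by rewrite /= !mul1r.
rewrite shiftsSr DM der_exp /=.
have -> : (h ^+ k * D h) *+ k.+1 * y + h ^+ k.+1 * D y - c 0%N *: (h ^+ k.+1 * y)
    = h ^+ k * (k.+1%:R *: (D h * y) + h * (D y - c 0%N *: y)).
  rewrite -mulr_natr exprSr [RHS]mulrDr mulrBr mulrBr -!scalerAr scaler_nat.
  by rewrite mulr_natr mulrnAl !mulrA addrA.
rewrite IH rmorphD eZ !rmorphM /= eh mul0r addr0 factS natrM exprSr. ring.
Qed.

End Derivations.

Section Descent.
Variables (p : nat) (K : fieldType) (v : K -> \bar int).
Hypothesis charK : p \in [pchar K].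
Hypothesis valK : discrete_valuation v.
Local Notation R := (val_ring v).
Variables (A : comAlgType K) (D : {linear A -> A}).
Hypothesis DM : forall a b, D (a * b) = D a * b + a * D b.
Variables (lam : K) (X : A).
Hypotheses (Rlam : R lam) (lam0 : lam != 0) (DX : D X = lam *: X) (Xp : X ^+ p = 1).
Let T : A := lam^-1 *: (X - 1).
Let fall := shifts D (fun j => j%:R * lam).

Lemma shifts_stable (J : set A) c k a : is_submod R J ->
    (forall a, J a -> J (D a)) -> (forall j, R (c j)) -> J a -> J (shifts D c k a).
Proof.
move=> JM JD Rc Ja; elim: k => //= k IH; apply: (submodB valK) => //; first exact: JD.
by case: JM => _ _ JZ; apply: JZ.
Qed.

Let p_gt1 : (1 < p)%N. Proof. exact/prime_gt1/(pcharf_prime charK). Qed.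

Let scalarXT : X = 1 + lam *: T.
Proof. by rewrite /T scalerA divff // scale1r addrC subrK. Qed.

(** The eigenvector [X] makes [D] into [X d/dT], and [e] is the value of [y] at
    [T = 0].  In terms of [S = T / X], for which [D S = 1 - lam S], Taylor's
    formula becomes [e = sum_k (-S)^k / k! (D (D - lam) ... (D - (k-1) lam)) y],
    which has no inverse of [X] in it.  Every term with [k > 0] involves [D y],
    hence lies in [J]. *)
Lemma descent (J : set A) y : is_submod R J ->
    (forall a, J a -> J (D a)) -> (forall a, J a -> J (T * a)) ->
    fall p y = 0 -> J (D y) ->
  exists2 e, D e = 0 & J (y - e).
Proof.
move=> JM JD JT y0 JDy.
have JX a : J a -> J (X * a).
  move=> Ja; rewrite scalarXT mulrDl mul1r -scalerAl; case: (JM) => _ JA JZ.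
  by apply: JA => //; apply: JZ => //; exact: JT.
(* As [X^p = 1], this is [T / X]. *)
pose S : A := X ^+ p.-1 * T.
have JSn a n : J a -> J (S ^+ n * a).
  move=> Ja; elim: n => [|n IH]; first by rewrite mul1r.
  rewrite exprS {1}/S -!mulrA; move: (JT _ IH); move: (_ * _) => b Jb.
  elim: (p.-1) => [|q IHq]; first by rewrite mul1r.
  by rewrite exprS -mulrA; apply: JX.
have XS : X * X ^+ p.-1 = 1 by rewrite -exprS prednK // (ltnW p_gt1).
have SE : S = lam^-1 *: (1 - X ^+ p.-1).
  by rewrite /S /T -scalerAr mulrBr mulr1 mulrC XS.
have DXp : D (X ^+ p.-1) = - (lam *: X ^+ p.-1).
  have := DM X (X ^+ p.-1); rewrite XS der1 // DX => /esym/eqP.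
  rewrite addrC addr_eq0 => /eqP E.
  have -> : D (X ^+ p.-1) = X ^+ p.-1 * (X * D (X ^+ p.-1)).
    by rewrite mulrA [_ * X]mulrC XS mul1r.
  by rewrite E mulrN -scalerAl XS -scalerAr mulr1.
have DS : D S = 1 - lam *: S.
  rewrite SE linearZ /= linearB /= der1 // DXp sub0r opprK !scalerA mulVf // divff //.
  by rewrite !scale1r opprB addrC subrK.
(* The images under [D] of the terms of [e] telescope; [g] is the sequence
   whose differences they are. *)
pose e := \sum_(k < p) ((-1) ^+ k / k`!%:R) *: (S ^+ k * fall k y).
pose g k := if k is j.+1 then ((-1) ^+ j / j`!%:R) *: (S ^+ j * fall j.+1 y) else 0.
have ek k : (k < p)%N ->
    D (((-1) ^+ k / k`!%:R) *: (S ^+ k * fall k y)) = g k.+1 - g k.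
  move=> kp; have -> : S ^+ k * fall k y = fall k y * S ^+ k by rewrite mulrC.
  rewrite linearZ /= DM der_exp // DS /=.
  case: k kp => [|k] kp.
    by rewrite mulr0n mulr0 addr0 mulr1 subr0 {2}/fall /= mul0r scale0r subr0 !mul1r.
  have -> : fall k.+2 y = D (fall k.+1 y) - (k.+1%:R * lam) *: fall k.+1 y by [].
  have -> : g k.+1 = - (((-1) ^+ k.+1 / k.+1`!%:R) *: (k.+1%:R *: (S ^+ k * fall k.+1 y))).
    rewrite scalerA -scaleNr /g; congr (_ *: _).
    have k0 : k.+1%:R != 0 :> K by apply: (natf_small_neq0 charK).
    have kf : k`!%:R != 0 :> K by apply: (factf_neq0 charK); apply: ltnW.
    rewrite factS natrM exprS; move: k0 kf; move: (k.+1%:R) (k`!%:R) => a b a0 b0.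
    by field; rewrite a0 b0.
  rewrite opprK -scalerDr; congr (_ *: _); set F := fall k.+1 y.
  rewrite -(mulr_algl lam S) -(mulr_algl (_ * _) F) -(mulr_algl k.+1%:R).
  rewrite -scalerA scaler_nat; set l := lam%:A; rewrite scaler_nat /= !exprS. ring.
exists e.
  rewrite linear_sum /= (eq_bigr (fun k : 'I_p => g k.+1 - g k)) => [|k _]; last exact: ek.
  rewrite -(big_mkord xpredT (fun k => g k.+1 - g k)) telescope_sumr //= subr0.
  by rewrite /g -(prednK (ltnW p_gt1)) // (prednK (ltnW p_gt1)) // y0 mulr0 scaler0.
have p0 : (0 < p)%N by exact: ltnW p_gt1.
rewrite /e; case: (p) p0 (charK) => // q _ charq.
rewrite big_ord_recl /= !mul1r invr1 scale1r opprD addNKr.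
apply: (submodN valK) => //; apply: (submod_sum _ JM) => i _; case: (JM) => _ _ JZ.
rewrite -[bump 0 i]/(i.+1); apply: JZ.
  apply: (vringM valK); last exact: vring_natV charK.
  exact/(vringX valK)/(vringN valK)/(vring1 valK).
apply: JSn; elim: (i : nat) => [|k IH] /=.
  by rewrite /fall /= mul0r scale0r subr0.
apply: (submodB valK) => //; first exact: JD.
by case: JM => _ _ JZ'; apply: JZ' => //; apply: (vringM valK) => //; exact: (vring_nat valK).
Qed.

(** Multiplication by [X^-k = X^(p - k)] shifts the eigenvalues of [D] by
    [- k lam]. *)
Lemma fall_shift k m x : (k <= p)%N ->
  fall m (X ^+ (p - k) * fall k x) = X ^+ (p - k) * fall (k + m)%N x.
Proof.
move=> kp; elim: m => [|m IH]; first by rewrite addn0.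
rewrite addnS /fall /= -/fall -/(fall m _) -/(fall (k + m)%N x) IH DM der_exp // DX.
set n := (p - k)%N.
have -> : (X ^+ n.-1 * (lam *: X)) *+ n = (- (k%:R * lam)) *: X ^+ n.
  rewrite -scalerAr -exprSr scalerMnl.
  have [n0|n0] := posnP n; last first.
    rewrite prednK //; congr (_ *: _).
    by rewrite -mulr_natl natrB // (pcharf0 charK) sub0r mulNr.
  have kE : k = p by apply/eqP; rewrite eqn_leq kp -subn_eq0 -/n n0.
  by rewrite n0 mulr0n scale0r kE (pcharf0 charK) mul0r oppr0 scale0r.
rewrite natrD mulrDl -!scalerAl scaleNr scalerDl mulrBr mulrDr -!scalerAr. ring.
Qed.

(** Climbs up from [fall p x = 0] to [fall 0 x = x]: if [M] contains
    [fall (k + 1) x], it contains the derivative of [y = X^-k fall k x], and by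
    [descent] it contains [y] up to a constant of [H], which is in [M] as well. *)
Lemma ascent (H M : set A) x : is_subalg R H -> is_subalg R M -> (M `<=` H)%classic ->
    (forall a, H a -> H (D a)) -> (forall a, M a -> M (D a)) -> M T ->
    (forall e, H e -> D e = 0 -> M e) ->
  H x -> fall p x = 0 -> M x.
Proof.
move=> HH MM sMH HD MD MT Mker Hx x0.
have [HS H1 HM] := HH; have [MS M1 MMu] := MM.
have MX : M X.
  by rewrite scalarXT; case: MS => _ MA MZ; apply: MA => //; apply: MZ.
suff Mfall k : (k <= p)%N -> M (fall (p - k)%N x) by have := Mfall p (leqnn p); rewrite subnn.
elim: k => [|k IH] kp; first by rewrite subn0 x0; case: MS.
set k' := (p - k.+1)%N; have k'p : (k' <= p)%N by exact: leq_subr.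
have Fx : fall k' x = X ^+ k' * (X ^+ (p - k') * fall k' x).
  by rewrite mulrA -exprD subnKC // Xp mul1r.
rewrite Fx; apply: (MMu); first exact: (subalgX _ MM MX).
set y := _ * _; have Hy : H y.
  apply: HM; first exact: (subalgX _ HH (sMH _ MX)).
  apply: shifts_stable => // j; apply: (vringM valK) => //; exact: vring_nat.
have [|||e De Mye] := @descent M y MS MD.
- by move=> a; apply: MMu.
- rewrite fall_shift // addnC.
  suff -> : fall (p + k')%N x = 0 by rewrite mulr0.
  elim: (k') => [|q IHq]; first by rewrite addn0.
  by rewrite addnS /fall /= -/fall -/(fall _ x) IHq linear0 scaler0 subr0.
- have -> : D y = fall 1 y by rewrite /fall /= mul0r scale0r subr0.
  rewrite fall_shift //; apply: MMu; first exact: (subalgX _ MM MX).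
  by rewrite addn1 /k' subnSK //; apply: IH; apply: ltnW.
have He : H e.
  rewrite -[e](subKr y); apply: (submodB valK HS Hy).
  exact: (sMH _ Mye).
rewrite -[y](subrK e); case: MS => _ MA _; apply: MA => //; exact: Mker.
Qed.

End Descent.

(** * Truncated exponentials *)

Section TruncatedExponential.
Variables (p : nat) (K : fieldType).
Hypothesis charK : p \in [pchar K].
Let p_gt1 : (1 < p)%N. Proof. exact/prime_gt1/(pcharf_prime charK). Qed.

(** The polynomial [X^p - X] has the [p] elements of the prime field as roots. *)
Lemma prod_shift_wp (a : K) : \prod_(j < p) (a - j%:R) = wp p a.
Proof.
pose P : {poly K} := 'X^p - 'X; pose rs : seq K := [seq j%:R | j <- index_iota 0 p].
have sP : size P = p.+1.
  by rewrite size_polyDl size_polyXn // size_polyN size_polyX.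
have lP : lead_coef P = 1.
  by rewrite lead_coefDl ?lead_coefXn // size_polyXn size_polyN size_polyX.
suff E : P = \prod_(z <- rs) ('X - z%:P).
  have -> : wp p a = P.[a] by rewrite /P !hornerE.
  rewrite E horner_prod big_map big_mkord.
  by apply: eq_bigr => j _; rewrite !hornerE.
rewrite {1}(@all_roots_prod_XsubC _ P rs) ?lP ?scale1r ?size_map ?size_iota ?subn0 //.
- apply/allP => _ /mapP[j _ ->]; rewrite rootE !hornerE.
  by rewrite -(pFrobenius_autE charK) pFrobenius_aut_nat subrr.
- rewrite uniq_rootsE map_inj_in_uniq ?iota_uniq // => i j.
  rewrite !mem_index_iota /=.
  wlog ij : i j / (i <= j)%N.
    by move=> W ip jp E; have [/W->//|/ltnW/W/(_ jp ip)] := leqP i j; move=> /(_ (esym E)).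
  move=> ip jp E; apply/eqP; rewrite eqn_leq ij leqNgt; apply/negP => ltij.
  have /negP[] : ((j - i)%N%:R != 0 :> K).
    by apply: (natf_small_neq0 charK); rewrite subn_gt0 ltij (leq_ltn_trans (leq_subr _ _) jp).
  by rewrite natrB // E subrr.
Qed.

Lemma gbinomS (a : K) m : (m.+1 < p)%N ->
  m.+1%:R * gbinom a m.+1 = (a - m%:R) * gbinom a m.
Proof.
move=> mp; rewrite /gbinom big_ord_recr factS natrM /=.
have := factf_neq0 charK (ltnW mp); have : m.+1%:R != 0 :> K by apply: (natf_small_neq0 charK).
move: (m.+1%:R) (m`!%:R) => b c b0 c0; field; by rewrite b0 c0.
Qed.

Lemma gbinom0 (a : K) : gbinom a 0 = 1.
Proof. by rewrite /gbinom big_ord0 mul1r invr1. Qed.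

(** The missing binomial coefficient of index [p] leaves a defect [wp p a] in
    the recursion [gbinomS], since [(p-1)! = -1] by Wilson's theorem. *)
Lemma gbinom_top (a : K) : p.-1%:R * gbinom a p.-1 = a * gbinom a p.-1 + wp p a.
Proof.
have W : (p.-1)`!%:R = -1 :> K.
  apply/eqP; rewrite -subr_eq0 opprK -(natrD _ _ 1%N) addn1 -(dvdn_pcharf charK).
  by rewrite -Wilson // (pcharf_prime charK).
rewrite -prod_shift_wp /gbinom W invrN1 -[in \prod_(j < p) _](prednK (ltnW p_gt1)) big_ord_recr /=.
ring.
Qed.

Variable A : comAlgType K.

(** The logarithmic derivative of [x^[a]] is [a] times that of [x], up to the
    effect of truncating the binomial series at degree [p]. *)
Lemma der_texp (D : {linear A -> A}) x y a :
    (forall a b, D (a * b) = D a * b + a * D b) -> D x = y * x ->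
  D (texp p x a) = y * (a *: texp p x a + wp p a *: (x - 1) ^+ p.-1).
Proof.
move=> DM Dx; rewrite /texp linear_sum /=.
have Dz : D (x - 1) = y * x by rewrite linearB /= der1 // subr0.
under eq_bigr => m _ do rewrite linearZ /= der_exp // Dz.
have -> : x = 1 + (x - 1) by rewrite addrC subrK.
set z := x - 1; rewrite [1 + z - 1]addrC addrA addNr add0r.
have gT := gbinom_top a; have gS := @gbinomS a.
case: p p_gt1 gT gS => // q _ /= gT gS.
have E m : gbinom a m *: (z ^+ m.-1 * (y * (1 + z)) *+ m) =
   y * ((m%:R * gbinom a m) *: z ^+ m.-1 + (m%:R * gbinom a m) *: z ^+ m).
  case: m => [|m]; first by rewrite mulr0n mul0r !scale0r addr0 scaler0 mulr0.
  rewrite /= -scalerDr -scalerAr exprS (mulrC m.+1%:R) -[RHS]scalerA scaler_nat.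
  by congr (_ *: (_ *+ _)); ring.
under eq_bigr => m _ do rewrite E.
rewrite -mulr_sumr; congr (y * _); rewrite big_split /=.
rewrite big_ord_recl mul0r scale0r add0r big_ord_recr [in RHS]big_ord_recr /=.
rewrite addrA -big_split /= gT scalerDl scalerDr !scalerA addrA; congr (_ + _ + _).
rewrite scaler_sumr; apply: eq_bigr => i _.
rewrite /bump /= add1n gS ?ltnS // -scalerDl scalerA; congr (_ *: _); ring.
Qed.

Lemma texp_mul_top (x : A) a : (x - 1) ^+ p = 0 ->
  (x - 1) ^+ p.-1 * texp p x a = (x - 1) ^+ p.-1.
Proof.
move=> z0; have pE := prednK (ltnW p_gt1); rewrite /texp mulr_sumr.
rewrite -pE big_ord_recl big1 /= ?addr0 => [|i _].
  by rewrite gbinom0 scale1r mulr1.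
by rewrite -scalerAr /bump add1n exprS mulrA -exprSr pE z0 mul0r scaler0.
Qed.

(** The two shapes in which [x1^[a] x2^[b]] gets differentiated: along the first
    variable, which moves [x2] by a multiple of the socle element
    [(x1 - 1)^(p-1)] as well, and along the second one. *)
Lemma der_texp_mull (D : {linear A -> A}) x1 x2 c d a b :
    (forall a b, D (a * b) = D a * b + a * D b) -> D x1 = c *: x1 ->
    D x2 = (d *: (x1 - 1) ^+ p.-1) * x2 -> (x1 - 1) ^+ p = 0 ->
  D (texp p x1 a * texp p x2 b) = (c * a) *: (texp p x1 a * texp p x2 b) +
    (x1 - 1) ^+ p.-1 * ((c * wp p a + d * b) *: texp p x2 b
                        + (d * wp p b) *: (x2 - 1) ^+ p.-1).
Proof.
move=> DM D1 D2 z0; have D1' : D x1 = c%:A * x1 by rewrite mulr_algl.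
rewrite DM (der_texp _ DM D1') (der_texp _ DM D2).
have zv := texp_mul_top a z0.
move: (texp p x1 a) (texp p x2 b) (_ ^+ _) (_ ^+ _) zv => v w y z zv.
rewrite mulr_algl scalerDr mulrDl -addrA !scalerA -!scalerAl; congr (_ + _).
rewrite -[v * _]scalerAr [v * (z * _)]mulrA [v * z]mulrC zv ![z * (_ + _)]mulrDr -!scalerAr scalerDr !scalerA addrA.
by rewrite -scalerDl.
Qed.

Lemma der_texp_mulr (D : {linear A -> A}) x1 x2 c a b :
    (forall a b, D (a * b) = D a * b + a * D b) -> D x1 = 0 -> D x2 = c *: x2 ->
  D (texp p x1 a * texp p x2 b) = (c * b) *: (texp p x1 a * texp p x2 b) +
    (c * wp p b) *: (texp p x1 a * (x2 - 1) ^+ p.-1).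
Proof.
move=> DM D1 D2; have D1' : D x1 = 0 * x1 by rewrite mul0r.
have D2' : D x2 = c%:A * x2 by rewrite mulr_algl.
rewrite DM (der_texp _ DM D1') (der_texp _ DM D2') !mul0r add0r mulr_algl.
by rewrite scalerDr !scalerA mulrDr -!scalerAr.
Qed.

Lemma texp_integral (v : K -> \bar int) (M : set A) lam T a :
    discrete_valuation v -> is_subalg (val_ring v) M -> M T ->
    val_ring v lam -> val_ring v (lam * a) ->
  M (texp p (1 + lam *: T) a).
Proof.
move=> valK MM MT Rlam Rla; have [MS _ _] := MM.
apply: (submod_sum _ MS) => m _; rewrite addrC addKr exprZn scalerA.
case: MS => _ _; apply; last exact: (subalgX _ MM MT).
rewrite /gbinom mulrAC; apply: (vringM valK); last exact: (vring_natV valK _ charK).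
rewrite -[X in _ * X]/(lam ^+ m) -[m in lam ^+ m]card_ord -prodr_const -big_split /=.
elim/big_ind: _ => [||j _]; [exact: vring1 | exact: vringM |].
rewrite mulrBl [a * _]mulrC; apply: (vringD valK) => //; apply: (vringN valK).
by apply: (vringM valK) => //; exact: vring_nat.
Qed.

Lemma texp_aug (e : {rmorphism A -> K}) x a :
    (forall c a, e (c *: a) = c * e a) -> e x = 1 ->
  e (texp p x a) = 1.
Proof.
move=> eZ ex; rewrite /texp rmorph_sum -(prednK (ltnW p_gt1)) big_ord_recl big1 /= ?addr0.
  by rewrite eZ gbinom0 rmorph1 mulr1.
by move=> i _; rewrite eZ rmorphXn rmorphB /= ex rmorph1 subrr /bump exprS mul0r mulr0.
Qed.

End TruncatedExponential.

(** * The group algebra of an abelian group *)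

(** [galg K gT] under a name that carries the proof of commutativity, so that
    it is a commutative algebra for type inference. *)
Definition cgalg (K : fieldType) (gT : finGroupType)
  (abG : abelian [set: gT]) : Type := galg K gT.

Section CommutativeGroupAlgebra.
Variables (K : fieldType) (gT : finGroupType) (abG : abelian [set: gT]).
Local Notation B := (cgalg K abG).

HB.instance Definition _ := GRing.Algebra.copy B (galg K gT).

Lemma cgalg_mulC : commutative (@GRing.mul B).
Proof.
have cG (x y : gT) : (x * y = y * x)%g by apply: (centsP abG); rewrite inE.
move=> a b; apply/ffunP => x; rewrite !ffunE.
rewrite (reindex_inj (inj_comp (mulgI x) invg_inj)) /=.
by apply: eq_bigr => y _; rewrite mulrC invMg invgK mulgKV cG.
Qed.

HB.instance Definition _ := GRing.PzRing_hasCommutativeMul.Build B cgalg_mulC.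


(** The action on [K[G]] of the element [f] of the dual algebra; it is a
    derivation if [f] is primitive in the dual, that is, additive ([gderM]). *)
Definition gder (f : gT -> K) (a : B) : B := [ffun g => f g * a g].

Fact gder_linear f : linear (gder f).
Proof.
by move=> c a b; apply/ffunP => g; rewrite !ffunE mulrDr; congr (_ + _); exact: mulrCA.
Qed.
HB.instance Definition _ f := GRing.isLinear.Build K B B *:%R (gder f) (gder_linear f).

(** The counit, with the commutative algebra as its domain, so that it can be
    declared a ring morphism. *)
Definition aug (a : B) : K := counit a.

Fact aug_zmod : zmod_morphism aug.
Proof. by move=> a b; rewrite /aug /counit -sumrB; apply: eq_bigr => g _; rewrite !ffunE. Qed.
HB.instance Definition _ := GRing.isZmodMorphism.Build B K aug aug_zmod.

Lemma augZ c a : aug (c *: a) = c * aug a.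
Proof. by rewrite /aug /counit mulr_sumr; apply: eq_bigr => g _; rewrite ffunE. Qed.

Definition grB (g : gT) : B := gr K g.

Lemma aug_gr g : aug (grB g) = 1.
Proof.
rewrite /aug /counit (bigD1 g) //= big1 ?addr0 ?ffunE ?eqxx // => h /negPf hg.
by rewrite ffunE hg.
Qed.

Lemma grBE (a : B) : a = \sum_(g : gT) a g *: grB g.
Proof. exact: (galgE a). Qed.

Lemma grBM g h : grB (g * h)%g = grB g * grB h.
Proof. exact: (grM K g h). Qed.

Lemma grB1 : grB 1%g = 1. Proof. by []. Qed.

Lemma grBX g n : grB (g ^+ n)%g = grB g ^+ n.
Proof. by elim: n => [|n IH]; rewrite ?expg0 // expgS grBM IH exprS. Qed.

Fact aug_monoid : monoid_morphism aug.
Proof.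
split=> [|a b]; first by rewrite -grB1 aug_gr.
rewrite [a in LHS]grBE [b in LHS]grBE mulr_suml raddf_sum [in RHS]/aug /counit mulr_suml.
apply: eq_bigr => g _; rewrite mulr_sumr raddf_sum mulr_sumr; apply: eq_bigr => h _.
by rewrite -scalerAl -scalerAr -grBM /= !augZ aug_gr mulr1.
Qed.
HB.instance Definition _ := GRing.isMonoidMorphism.Build B K aug aug_monoid.


Definition additive_char (f : gT -> K) := {morph f : g h / (g * h)%g >-> g + h}.

Lemma gderM f a b : additive_char f -> gder f (a * b) = gder f a * b + a * gder f b.
Proof.
move=> fM; apply/ffunP => x; rewrite !ffunE mulr_sumr -big_split /=.
apply: eq_bigr => y _; rewrite !ffunE -[in LHS](mulKVg y x) fM mulKg; ring.
Qed.

Lemma gder_gr f g : gder f (grB g) = f g *: grB g.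
Proof.
apply/ffunP => h; rewrite !ffunE; have [->|hg] := eqVneq h g; first by [].
by rewrite mulr0 [_ *: _]mulr0.
Qed.

Lemma aug_gder f a : aug (gder f a) = \sum_(g : gT) f g * a g.
Proof. by apply: eq_bigr => g _; rewrite ffunE. Qed.

Lemma aug_gderM f a b : additive_char f ->
  aug (gder f (a * b)) = aug (gder f a) * aug b + aug a * aug (gder f b).
Proof. by move=> fM; rewrite gderM // rmorphD !rmorphM. Qed.

Lemma gder_comp f f' a : gder f (gder f' a) = gder (fun g => f g * f' g) a.
Proof. by apply/ffunP => g; rewrite !ffunE mulrA. Qed.

Lemma iter_gder f k a : iter k (gder f) a = gder (fun g => f g ^+ k) a.
Proof.
elim: k => [|k IH]; first by apply/ffunP => g; rewrite ffunE mul1r.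
by rewrite iterS IH gder_comp; apply/ffunP => g; rewrite !ffunE exprS.
Qed.

Lemma gderC f f' a : gder f (gder f' a) = gder f' (gder f a).
Proof. by rewrite !gder_comp; apply/ffunP => g; rewrite !ffunE [f g * _]mulrC. Qed.

Lemma eq_gder f f' (a : B) : (forall g, a g != 0 -> f g = f' g) -> gder f a = gder f' a.
Proof.
move=> E; apply/ffunP => g; rewrite !ffunE.
by have [->|/E->//] := eqVneq (a g) 0; rewrite !mulr0.
Qed.

Lemma gder_eq0 f (a : B) : gder f a = 0 <-> (forall g, a g != 0 -> f g = 0).
Proof.
split=> [/ffunP E g ag|E].
  by have := E g; rewrite !ffunE => /eqP; rewrite mulf_eq0 (negPf ag) orbF => /eqP.
by rewrite (eq_gder E); apply/ffunP => g; rewrite !ffunE mul0r.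
Qed.

Lemma shifts_gder f c k (a : B) :
  shifts (gder f) c k a = [ffun g => (\prod_(j < k) (f g - c j)) * a g].
Proof.
apply/ffunP => g; elim: k => [|k IH]; first by rewrite ffunE big_ord0 mul1r.
by move: IH; rewrite !ffunE big_ord_recr /= => ->; rewrite -[_ *: _]/(_ * _); ring.
Qed.

End CommutativeGroupAlgebra.

(** Frobenius is additive and every group element has p-th power 1. *)
Lemma cgalg_pow_p (p : nat) (K : fieldType) (gT : finGroupType)
    (abG : abelian [set: gT]) (a : cgalg K abG) :
  p \in [pchar K] -> p.-abelem%g [set: gT]%SET -> a ^+ p = (aug a ^+ p)%:A.
Proof.
move=> charK abelG; have charB : p \in [pchar (cgalg K abG)] by rewrite (pchar_lalg (cgalg K abG)).
rewrite {1}[a]grBE -(pFrobenius_autE charB) rmorph_sum /= [aug a]/aug /counit.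
rewrite -(pFrobenius_autE charK) rmorph_sum /= scaler_suml; apply: eq_bigr => g _.
rewrite !pFrobenius_autE exprZn -grBX.
have -> : (g ^+ p = 1)%g by case/(abelemP (pcharf_prime charK)): abelG => _; apply; rewrite inE.
by rewrite grB1.
Qed.

(** * Functionals that are integral on a Hopf order *)

Section IntegralFunctionals.
Variables (K : fieldType) (v : K -> \bar int).
Hypothesis valK : discrete_valuation v.
Local Notation R := (val_ring v).
Variables (gT : finGroupType) (abG : abelian [set: gT]).
Local Notation B := (cgalg K abG).

Lemma additive_char1 (f : gT -> K) : additive_char f -> f 1%g = 0.
Proof.
by move=> fM; apply: (addIr (f 1%g)); rewrite add0r -fM mulg1.
Qed.

(** As [counit o D_f] is a derivation at the counit, its integrality on an algebra
    has to be checked on generators only. *)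
Lemma integral_subalg f : additive_char f ->
  is_subalg R [set a : B | R (aug a) /\ R (aug (gder f a))]%classic.
Proof.
move=> fM; have gder1 : aug (gder f (1 : B)) = 0.
  by rewrite -grB1 gder_gr additive_char1 // scale0r rmorph0.
split; [split | |]; rewrite /mkset /=.
- by rewrite linear0 !rmorph0; split; exact: vring0.
- move=> x y [xR xfR] [yR yfR]; rewrite linearD !rmorphD; split; exact: vringD.
- move=> c x cR [xR xfR]; rewrite linearZ /= !augZ; split; exact: vringM.
- by rewrite rmorph1 gder1; split; [exact: vring1|exact: vring0].
- move=> x y [xR xfR] [yR yfR]; rewrite aug_gderM // rmorphM.
  by split; [exact: vringM | apply: vringD => //; exact: vringM].
Qed.

Variable H : set B.
Hypothesis comultH : forall a, H a -> lspan R
  [set t | exists a1 a2 : B, [/\ H a1, H a2 & t = tens a1 a2]]%classic (comult a).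
Hypothesis HS : is_submod R H.

(** [D_f] is [(id (x) (counit o D_f)) o comult], and [comult] maps [H] to
    [H (x) H]. *)
Lemma gder_stable (f : gT -> K) a :
  (forall a, H a -> R (aug (gder f a))) -> H a -> H (gder f a).
Proof.
move=> fR Ha; pose L (t : galg K (gT * gT)%type) : B :=
  [ffun x => \sum_(y : gT) f y * t (x, y)].
have LE : L (comult a) = gder f a.
  apply/ffunP => x; rewrite !ffunE (bigD1 x) //= big1 ?addr0 => [|y yx].
    rewrite /comult /galg_map sum_ffunE (bigD1 x) //= big1 ?addr0 => [|g gx].
      by rewrite !ffunE eqxx [_ *: _]mulr1.
    by rewrite !ffunE xpair_eqE eq_sym (negPf gx) [_ *: _]mulr0.
  rewrite /comult /galg_map sum_ffunE big1 ?mulr0 // => g _.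
  rewrite !ffunE xpair_eqE; have [<-|_] := eqVneq x g; last by rewrite [_ *: _]mulr0.
  by rewrite (negPf yx) [_ *: _]mulr0.
rewrite -LE; have [H0 HD HZ] := HS.
apply: (lspan_min (M := [set t | H (L t)]%classic) _ _ (comultH Ha)); last first.
  move=> t [a1 [a2 [Ha1 Ha2 ->]]] /=.
  have -> : L (tens a1 a2) = aug (gder f a2) *: a1.
    apply/ffunP => x; rewrite !ffunE aug_gder -[_ *: _]/(_ * _) mulr_suml.
    by apply: eq_bigr => y _; rewrite ffunE /= [a1 x * _]mulrC mulrA.
  by apply: HZ => //; exact: fR.
split=> /= [|t t' Ht Ht'|c t Rc Ht].
- suff -> : L 0 = 0 by [].
  by apply/ffunP => x; rewrite !ffunE big1 // => y _; rewrite ffunE mulr0.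
- suff -> : L (t + t') = L t + L t' by exact: HD.
  apply/ffunP => x; rewrite !ffunE -big_split; apply: eq_bigr => y _.
  by rewrite ffunE mulrDr.
- suff -> : L (c *: t) = c *: L t by exact: HZ.
  apply/ffunP => x; rewrite !ffunE -[RHS]/(_ * _) mulr_sumr; apply: eq_bigr => y _.
  by rewrite ffunE mulrCA.
Qed.

Hypothesis augH : forall a, H a -> R (aug a).
Variable pi : K.
Hypothesis vpi : v pi = 1%:E.
Hypothesis spanH : lspan [set: K]%classic H = [set: B]%classic.
Hypothesis fgH : fg_projective R H.

Let pi0 : pi != 0.
Proof. by apply/eqP => p0; case: valK => v0 _ _ _; move/v0: p0; rewrite vpi. Qed.

Let Rpi n : R (pi ^+ n).
Proof. by apply: vringX => //; rewrite /val_ring /= vpi lee_fin. Qed.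

Lemma scaled_mem (a : B) : exists n, H (pi ^+ n *: a).
Proof.
have [H0 HD HZ] := HS.
have Ka : lspan [set: K]%classic H a by rewrite spanH.
apply: (lspan_min (M := [set a : B | exists n, H (pi ^+ n *: a)]%classic) _ _ Ka); last first.
  by move=> b Hb; exists 0%N; rewrite expr0 scale1r.
split=> /= [|x y [m Hm] [n Hn]|c x _ [n Hn]].
- by exists 0%N; rewrite scaler0.
- exists (m + n)%N; rewrite scalerDr exprD -{1}[pi ^+ m * _]mulrC -!scalerA.
  by apply: HD; apply: HZ.
- have [m Rm] := bounded_scale valK c vpi.
  exists (m + n)%N; rewrite exprD -scalerA (scalerA _ c) mulrC -scalerA scalerA.
  by apply: HZ.
Qed.

(** Functionals that are integral on [H] are closed under product, by
    [gder_stable], hence the powers of such an [f] are integral on a fixed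
    multiple of [g], which bounds the powers of [f g]. *)
Lemma functional_integral f g : (forall a, H a -> R (aug (gder f a))) -> R (f g).
Proof.
move=> fR; have [m Hm] := scaled_mem (grB K abG g).
apply: (vring_pow_bounded valK (expf_neq0 m pi0)) => n.
suff /augH : H (gder (fun g => f g ^+ n) (pi ^+ m *: grB K abG g)).
  by rewrite linearZ /= gder_gr !augZ aug_gr mulr1.
rewrite -iter_gder; elim: n => //= n IH; exact: gder_stable.
Qed.

(** A finitely generated projective module contains the vectors on which its
    coordinate functionals [F i] are integral. *)
Lemma grB_mem g : H (grB K abG g).
Proof.
have [n [e [He [s [sR sD sZ se]]]]] := fgH.
have [H0 HD HZ] := HS.
have mem_e i : H (e i) by rewrite He; apply: mem_lspan; exists i.
have s0 i : s 0 i = 0.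
  by have := sZ 0 0 i (vring0 valK) H0; rewrite scaler0 mul0r.
have ssum (r : seq gT) c (y : gT -> B) i : (forall g, R (c g)) -> (forall g, H (y g)) ->
    s (\sum_(g <- r) c g *: y g) i = \sum_(g <- r) c g * s (y g) i.
  move=> cR yH; elim: r => [|h r IH]; first by rewrite !big_nil s0.
  rewrite !big_cons sD ?sZ ?IH //; first exact: HZ.
  by apply: (submod_sum _ HS) => h' _; apply: HZ.
have [m Hm] := fin_all_exists (fun g => scaled_mem (grB K abG g)).
pose F i h := (pi ^+ m h)^-1 * s (pi ^+ m h *: grB K abG h) i.
have FE i a : H a -> aug (gder (F i) a) = s a i.
  move=> Ha; have [l Rl] := fin_all_exists (fun h => bounded_scale valK (a h / pi ^+ m h) vpi).
  pose L := (\sum_h l h)%N; have piL := expf_neq0 L pi0.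
  have RL h : R (pi ^+ L * (a h / pi ^+ m h)).
    rewrite /L (bigD1 h) //= addnC exprD -mulrA; apply: vringM => //; exact: Rpi.
  apply: (mulfI piL); rewrite -sZ //.
  have -> : pi ^+ L *: a =
      \sum_h (pi ^+ L * (a h / pi ^+ m h)) *: (pi ^+ m h *: grB K abG h).
    rewrite {1}[a]grBE scaler_sumr; apply: eq_bigr => h _.
    by rewrite !scalerA -[in RHS]mulrA mulfVK // expf_neq0.
  rewrite ssum // aug_gder mulr_sumr; apply: eq_bigr => h _.
  by rewrite /F; ring.
have FR i h : R (F i h).
  by apply: functional_integral => a Ha; rewrite FE //; exact: sR.
have -> : grB K abG g = \sum_(i < n) F i g *: e i.
  have pm := expf_neq0 (m g) pi0.
  rewrite -[LHS]scale1r -(mulVf pm) -scalerA -[in LHS](se _ (Hm g)) scaler_sumr.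
  by apply: eq_bigr => i _; rewrite scalerA.
by apply: (submod_sum _ HS) => i _; apply: HZ.
Qed.

End IntegralFunctionals.

(** * Coordinates on an elementary abelian group of rank three *)

Section Coordinates.
Variables (p : nat) (gT : finGroupType) (g1 g2 g3 : gT).
Hypothesis pr_p : prime p.
Hypothesis abelG : p.-abelem%g [set: gT]%SET.
Hypothesis cardG : #|[set: gT]%SET| = (p ^ 3)%N.
Hypothesis genG : <<[set g1; g2; g3]%SET>>%g = [set: gT]%SET.

Definition monom (a b c : nat) : gT := (g1 ^+ a * g2 ^+ b * g3 ^+ c)%g.

Let cG (x y : gT) : (x * y = y * x)%g.
Proof. by apply: (centsP (abelem_abelian abelG)); rewrite inE. Qed.

Let expp (x : gT) : (x ^+ p = 1)%g.
Proof. by case/(abelemP pr_p): abelG => _; apply; rewrite inE. Qed.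

Lemma monomM a b c a' b' c' :
  (monom a b c * monom a' b' c')%g = monom (a + a') (b + b') (c + c').
Proof.
have cGA (x y z : gT) : (x * (y * z) = y * (x * z))%g by rewrite !mulgA [(x * y)%g]cG.
rewrite /monom !expgD -!mulgA (cGA (g3 ^+ c)%g (g1 ^+ a')%g) (cGA (g2 ^+ b)%g (g1 ^+ a')%g).
by rewrite (cGA (g3 ^+ c)%g (g2 ^+ b')%g).
Qed.

Lemma monom_mod a b c : monom (a %% p) (b %% p) (c %% p) = monom a b c.
Proof. by rewrite /monom !expg_mod. Qed.

Lemma monom_onto g : exists abc : nat * nat * nat, monom abc.1.1 abc.1.2 abc.2 = g.
Proof.
pose f (t : 'I_p * 'I_p * 'I_p) := monom t.1.1 t.1.2 t.2.
have p0 := prime_gt0 pr_p.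
have fE a b c : monom a b c \in f @: [set: 'I_p * 'I_p * 'I_p]%SET.
  apply/imsetP; exists (Ordinal (ltn_pmod a p0), Ordinal (ltn_pmod b p0), Ordinal (ltn_pmod c p0)).
    by rewrite inE.
  by rewrite /f /= monom_mod.
have gS : group_set (f @: [set: 'I_p * 'I_p * 'I_p]%SET).
  apply/group_setP; split; first by have := fE 0%N 0%N 0%N; rewrite /monom !mulg1.
  by move=> _ _ /imsetP[t _ ->] /imsetP[u _ ->]; rewrite monomM.
have : g \in <<[set g1; g2; g3]%SET>>%g by rewrite genG inE.
have /fintype.subsetP/[apply] : <<[set g1; g2; g3]%SET>>%g \subset Group gS.
  rewrite gen_subG; apply/fintype.subsetP => x; rewrite !inE => /orP[/orP[]|] /eqP->.
  - by have := fE 1%N 0%N 0%N; rewrite /monom !mulg1.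
  - by have := fE 0%N 1%N 0%N; rewrite /monom mulg1 mul1g.
  - by have := fE 0%N 0%N 1%N; rewrite /monom mulg1 mul1g.
by case/imsetP=> t _ ->; exists (t.1.1 : nat, t.1.2 : nat, t.2 : nat).
Qed.

(** A surjection of a set of [p^3] triples onto [G] is a bijection. *)
Lemma monom_inj a b c a' b' c' : monom a b c = monom a' b' c' ->
  [/\ a = a' %[mod p], b = b' %[mod p] & c = c' %[mod p]].
Proof.
pose f (t : 'I_p * 'I_p * 'I_p) := monom t.1.1 t.1.2 t.2.
have p0 := prime_gt0 pr_p.
pose o n := Ordinal (ltn_pmod n p0).
have fE x y z : f (o x, o y, o z) = monom x y z by exact: monom_mod.
have finj : injective f.
  suff /imset_injP fi : #|f @: [set: 'I_p * 'I_p * 'I_p]%SET| == #|[set: 'I_p * 'I_p * 'I_p]%SET|.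
    by move=> t u; apply: fi; rewrite inE.
  have -> : f @: [set: 'I_p * 'I_p * 'I_p]%SET = [set: gT]%SET.
    apply/setP => g; rewrite inE; have [[[x y] z] /= <-] := monom_onto g.
    by rewrite -fE imset_f ?inE.
  by rewrite cardG cardsT !card_prod card_ord !expnS expn0 muln1 mulnA.
rewrite -(fE a) -(fE a') => /finj[ea eb ec]; by split.
Qed.

Variable K : fieldType.
Hypothesis charK : p \in [pchar K].

Lemma coordinate_chars : exists chi1 chi2 chi3 : gT -> K,
  [/\ additive_char chi1, additive_char chi2, additive_char chi3
    & forall a b c, [/\ chi1 (monom a b c) = a%:R, chi2 (monom a b c) = b%:R
                      & chi3 (monom a b c) = c%:R]].
Proof.
have [k kE] := fin_all_exists monom_onto.
have natr_mod a b : a = b %[mod p] -> a%:R = b%:R :> K.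
  by move=> E; rewrite -(GRing.natr_mod_pchar charK a) E GRing.natr_mod_pchar.
have kM g h : [/\ (k (g * h)%g).1.1 = ((k g).1.1 + (k h).1.1) %[mod p],
   (k (g * h)%g).1.2 = ((k g).1.2 + (k h).1.2) %[mod p]
   & (k (g * h)%g).2 = ((k g).2 + (k h).2) %[mod p]]%N.
  by apply: monom_inj; rewrite -monomM !kE.
exists (fun g => (k g).1.1%:R), (fun g => (k g).1.2%:R), (fun g => (k g).2%:R).
split.
- by move=> g h /=; rewrite -natrD; apply: natr_mod; have [] := kM g h.
- by move=> g h /=; rewrite -natrD; apply: natr_mod; have [] := kM g h.
- by move=> g h /=; rewrite -natrD; apply: natr_mod; have [] := kM g h.
move=> a b c; have [] := @monom_inj _ _ _ a b c (kE (monom a b c)).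
by move=> /natr_mod -> /natr_mod -> /natr_mod ->.
Qed.

End Coordinates.

(** * Functionals on the group algebra of a quotient *)

Section QuotientFunctional.
Variables (K : fieldType) (gT : finGroupType) (N : {group gT}).
Hypothesis abG : abelian [set: gT].

Lemma coset_abelian : abelian [set: coset_of N].
Proof.
apply/centsP => X _ Y _; case: (cosetP X) => x Nx ->; case: (cosetP Y) => y Ny ->.
by rewrite /commute -!morphM //; congr (coset _ _); apply: (centsP abG); rewrite inE.
Qed.

Lemma memN (g : gT) : g \in 'N(N)%g.
Proof.
by apply: (fintype.subsetP (sub_abelian_norm abG (finset.subsetT N))); rewrite inE.
Qed.

Variable f : gT -> K.
Hypothesis fM : additive_char f.
Hypothesis fN : forall g, g \in N -> f g = 0.

Definition coset_char (X : coset_of N) : K := f (repr X).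

Lemma coset_charE g : coset_char (coset N g) = f g.
Proof.
rewrite /coset_char; set x := repr _.
have xN : (x * g^-1)%g \in N.
  apply: coset_idr; first exact: memN.
  by rewrite morphM ?memN // morphV ?memN //= coset_reprK mulgV.
by rewrite -[x](mulgKV g) fM fN // add0r.
Qed.

Lemma coset_charM : additive_char coset_char.
Proof.
move=> X Y; case: (cosetP X) => x Nx ->; case: (cosetP Y) => y Ny ->.
by rewrite -morphM // !coset_charE fM.
Qed.

Lemma gder_coset (a : cgalg K abG) :
  aug (gder coset_char (galg_map (coset N) a : cgalg K coset_abelian)) = aug (gder f a).
Proof.
rewrite /galg_map linear_sum rmorph_sum aug_gder; apply: eq_bigr => g _.
rewrite linearZ /= augZ -/(grB K coset_abelian _) gder_gr augZ aug_gr mulr1.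
by rewrite coset_charE mulrC.
Qed.

Lemma aug_coset (a : cgalg K abG) :
  aug (galg_map (coset N) a : cgalg K coset_abelian) = aug a.
Proof.
rewrite /galg_map rmorph_sum [RHS]/aug /counit; apply: eq_bigr => g _.
by rewrite /= augZ -/(grB K coset_abelian _) aug_gr mulr1.
Qed.

End QuotientFunctional.

(** * Approximate logarithmic derivatives *)

Section LogarithmicDerivatives.
Variables (p : nat) (K : fieldType) (v : K -> \bar int).
Hypothesis charK : p \in [pchar K].
Hypothesis valK : discrete_valuation v.
Local Notation R := (val_ring v).
Variables (A : comAlgType K) (D : {linear A -> A}) (H : set A).
Hypothesis DM : forall a b, D (a * b) = D a * b + a * D b.
Hypothesis HH : is_subalg R H.
Variables (lam a : K).
Hypothesis Ra : R a.

Lemma alg_gen_der (Y : set A) : (forall y, Y y -> alg_gen R Y (D y)) ->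
  forall x, alg_gen R Y x -> alg_gen R Y (D x).
Proof.
have [[M0 MD MZ] M1 MM] := alg_gen_subalg R Y.
move=> DY x Yx; have [] // : [set x | alg_gen R Y x /\ alg_gen R Y (D x)]%classic x.
apply: (alg_gen_min _ _ Yx); last by move=> y Yy; split; [exact: mem_alg_gen|exact: DY].
split; [split | |] => /=.
- by rewrite linear0.
- by move=> y z [My Mdy] [Mz Mdz]; rewrite linearD; split; exact: MD.
- by move=> c y Rc [My Mdy]; rewrite linearZ; split; exact: MZ.
- by rewrite der1.
- move=> y z [My Mdy] [Mz Mdz]; rewrite DM; split; first exact: MM.
  by apply: MD; exact: MM.
Qed.

Lemma iter_der_approx k u r : (forall x, H x -> H (D x)) -> H u -> H r ->
    D u = a *: u + lam *: r ->
  exists2 s, H s & iter k D u = a ^+ k *: u + lam *: s.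
Proof.
move=> HD Hu Hr Du; have [[H0 HA HZ] _ _] := HH.
elim: k => [|k [s Hs IH]].
  by exists 0 => //; rewrite scaler0 addr0 scale1r.
exists (a ^+ k *: r + D s).
  by apply: (HA); [apply: HZ => //; exact: vringX | exact: HD].
rewrite iterS IH linearD !linearZ /= Du !scalerDr !scalerA -exprSr addrA.
by rewrite [lam * _]mulrC.
Qed.

(** Equal logarithmic derivatives modulo [lam] cancel in a quotient; [w^(p-1)]
    stands for the inverse of [w], which it is up to a constant of [D]. *)
Lemma der_quot_approx u w r s : H u -> H w -> H r -> H s ->
    D u = a *: u + lam *: r -> D w = a *: w + lam *: s ->
  exists2 q, H q & D (u * w ^+ p.-1) = lam *: q.
Proof.
move=> Hu Hw Hr Hs Du Dw; have [[H0 HA HZ] H1 HM] := HH.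
exists (r * w ^+ p.-1 + (p.-1)%:R *: (u * (w ^+ p.-2 * s))).
  apply: (HA); first by apply: (HM) => //; exact: (subalgX _ HH Hw).
  apply: (HZ); first exact: vring_nat.
  by apply: (HM) => //; apply: (HM) => //; exact: (subalgX _ HH Hw).
have p_gt1 : (1 < p)%N by exact/prime_gt1/(pcharf_prime charK).
have p1 : (p.-1)%:R = -1 :> K.
  apply/eqP; rewrite -subr_eq0 opprK -(natrD _ _ 1%N) addn1 prednK ?(ltnW p_gt1) //.
  by rewrite (pcharf0 charK).
have wE : w ^+ p.-1 = w * w ^+ p.-2 by rewrite -exprS prednK // -ltnS prednK // ltnW.
rewrite DM der_exp // Du Dw -scaler_nat p1 wE.
rewrite !scaleN1r -(mulr_algl a u) -(mulr_algl a w) -(mulr_algl lam r) -(mulr_algl lam s).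
by rewrite -(mulr_algl lam (_ + _)); move: (a%:A) (lam%:A) => a' l'; ring.
Qed.

End LogarithmicDerivatives.

(** * Lifting an eigenvector *)

Section EigenvectorLift.
Variables (p : nat) (K : fieldType) (v : K -> \bar int).
Hypothesis charK : p \in [pchar K].
Hypothesis valK : discrete_valuation v.
Local Notation R := (val_ring v).
Variables (gT : finGroupType) (abelG : p.-abelem%g [set: gT]%SET).
Variable abG : abelian [set: gT].
Local Notation B := (cgalg K abG).
Variables (f : gT -> K) (lam : K).
Hypothesis fM : additive_char f.
Let p_gt1 : (1 < p)%N. Proof. exact/prime_gt1/(pcharf_prime charK). Qed.

Lemma fermat_wp k : wp p (k%:R : K) = 0.
Proof. by rewrite /wp -(pFrobenius_autE charK) pFrobenius_aut_nat subrr. Qed.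

(** On the support of [a] the eigenvalues of [D_f] are [lam] times elements of the
    prime field, which are all roots of the falling factorial. *)
Lemma fall_gder0 (a : B) : (forall g, a g != 0 -> exists k, f g = k%:R * lam) ->
  shifts (gder f) (fun j => j%:R * lam) p a = 0.
Proof.
move=> fk; rewrite shifts_gder; apply/ffunP => g; rewrite !ffunE.
have [->|/fk[k ->]] := eqVneq (a g) 0; first by rewrite mulr0.
under eq_bigr => j _ do rewrite -mulrBl.
by rewrite big_split /= (prod_shift_wp charK) fermat_wp !mul0r.
Qed.

(** [h] stands for a lift of the generator [(g - 1) / lam] of the quotient.  The
    product of all [D_f - j lam] with [j] nonzero in the prime field projects onto
    the kernel of [D_f], and it maps [h^(p-1)] to a unit; solving
    [(D_f - lam) W = 1] amounts to omitting one factor of it. *)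
Lemma eigen_lift (H : set B) h : (forall g, exists k, f g = k%:R * lam) ->
    R lam -> is_subalg R H -> (forall a, H a -> H (gder f a)) ->
    H h -> aug h = 0 -> aug (gder f h) = 1 ->
  exists W, [/\ H W, aug W = 0 & gder f W = 1 + lam *: W].
Proof.
move=> fk Rlam HH HD Hh h0 h1; have [HS H1 HM] := HH; have [H0 HA HZ] := HS.
(* The factors run over the nonzero [j] in such an order that the last one is
   [D_f + (p-1) lam = D_f - lam]. *)
pose c j : K := - (j.+1%:R * lam).
have Rc j : R (c j) by apply: vringN => //; apply: vringM => //; exact: vring_nat.
have dM a b := @gderM K gT abG f a b fM.
pose c' : B := shifts (gder f) c p.-1 (h ^+ p.-1).
have Hc' : H c' by apply: (shifts_stable valK) => //; exact: (subalgX _ HH Hh).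
pose kap : K := (p.-1)`!%:R.
have kap0 : kap != 0 by apply: (factf_neq0 charK); rewrite prednK // ltnW.
have augc' : aug c' = kap.
  rewrite /c' -[h ^+ _]mulr1 (shifts_aug dM) ?h0 //; last exact: augZ.
  by rewrite /= h1 expr1n rmorph1 !mulr1.
have Dc' : gder f c' = 0.
  rewrite /c' shifts_gder; apply/ffunP => g; rewrite !ffunE mulrA.
  suff -> : f g * \prod_(j < p.-1) (f g - c j) = 0 by rewrite mul0r.
  have [k ->] := fk g.
  have : wp p (- k%:R : K) = 0.
    by rewrite /wp -(pFrobenius_autE charK) rmorphN /= pFrobenius_aut_nat subrr.
  rewrite -(prod_shift_wp charK); case: (p) p_gt1 => // q _ /=.
  rewrite big_ord_recl subr0 => /eqP; rewrite mulf_eq0 oppr_eq0 => /orP[/eqP->|/eqP E].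
    by rewrite !mul0r.
  suff -> : \prod_(j < q) (k%:R * lam - c j) =
      \prod_(j < q) - lam * \prod_(j < q) (- k%:R - (bump 0 j)%:R) by rewrite E !mulr0.
  rewrite -big_split; apply: eq_bigr => j _; rewrite /c /bump add1n /=; ring.
pose ci : B := (kap ^- p) *: c' ^+ p.-1.
have ciM : ci * c' = 1.
  rewrite /ci -scalerAl -exprSr prednK ?(ltnW p_gt1) // (cgalg_pow_p _ charK abelG) augc' scalerA.
  by rewrite mulVf ?scale1r // expf_neq0.
have Hci : H ci.
  apply: (HZ); last exact: (subalgX _ HH Hc').
  rewrite -exprVn; apply: vringX => //; exact: vring_natV charK.
have Dci : gder f ci = 0.
  by rewrite linearZ /= (der_exp dM) /= Dc' mulr0 mul0rn scaler0.
pose W : B := shifts (gder f) c p.-2 (ci * h ^+ p.-1).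
have pE : p.-1 = p.-2.+1 by rewrite prednK // -ltnS prednK // ltnW.
exists W; split.
- apply: (shifts_stable valK) => //; apply: (HM) => //; exact: (subalgX _ HH Hh).
- rewrite /W pE exprSr mulrCA (shifts_aug dM) ?h0 //; last exact: augZ.
  by rewrite rmorphM /= h0 !mulr0.
have : shifts (gder f) c p.-2.+1 (ci * h ^+ p.-1) = 1.
  by rewrite -pE (shiftsMl dM) // -/c' ciM.
rewrite /= -/W => /eqP; rewrite subr_eq => /eqP ->; congr (_ + _ *: _).
rewrite /c -pE -mulNr.
suff -> : - (p.-1)%:R = 1 :> K by rewrite mul1r.
by apply/eqP; rewrite eqr_oppLR -subr_eq0 opprK -(natrD _ _ 1%N) addn1 prednK ?(pcharf0 charK) // ltnW.
Qed.

End EigenvectorLift.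

(** * Hopf orders in the group algebra *)

Section HopfOrderInRankThree.
Variables (p : nat) (K : fieldType) (v : K -> \bar int) (pi : K).
Hypothesis charK : p \in [pchar K].
Hypothesis valK : discrete_valuation v.
Hypothesis vpi : v pi = 1%:E.
Local Notation R := (val_ring v).
Variables (gT : finGroupType) (g1 g2 g3 : gT).
Hypothesis abelG : p.-abelem%g [set: gT]%SET.
Variable abG : abelian [set: gT].
Local Notation B := (cgalg K abG).
Local Notation G := (@grB K gT abG).

Variables chi1 chi2 chi3 : gT -> K.
Hypotheses (chi1M : additive_char chi1) (chi2M : additive_char chi2)
  (chi3M : additive_char chi3).
Hypothesis chiE : forall a b c, [/\ chi1 (monom g1 g2 g3 a b c) = a%:R,
  chi2 (monom g1 g2 g3 a b c) = b%:R & chi3 (monom g1 g2 g3 a b c) = c%:R].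
Hypothesis monomP : forall g, exists abc : nat * nat * nat,
  monom g1 g2 g3 abc.1.1 abc.1.2 abc.2 = g.

Variables (H : set B) (i1 i2 i3 : nat) (mu : K).
Let l1 := pi ^+ i1.
Let l2 := pi ^+ i2.
Let l3 := pi ^+ i3.
Let omega := pi ^+ (p * i1) * wp p mu / l2.
Hypothesis Romega : R omega.

Variables x1 x2 : B.
Hypotheses (x1G : x1 = G g1) (x2G : x2 = G g2 * texp p x1 mu).
Let t1 : B := divpi pi i1 x1.
Let t2 : B := divpi pi i2 x2.
Local Notation D3 := (gder (abG := abG) (fun g => l3 * chi3 g)).

Hypothesis HH : is_subalg R H.
Hypothesis augH : forall a, H a -> R (aug a).
Hypothesis derH : forall (f : gT -> K) a,
  (forall a, H a -> R (aug (gder f a))) -> H a -> H (gder f a).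
Hypothesis GH : forall g, H (G g).
Hypothesis D3R : forall a, H a -> R (aug (D3 a)).
Hypothesis kerH : forall a, (H a /\ D3 a = 0) <-> alg_gen R [set t1; t2]%classic a.

Let pr_p : prime p. Proof. exact: pcharf_prime charK. Qed.
Let p_gt1 : (1 < p)%N. Proof. exact: prime_gt1. Qed.

Let pi0 : pi != 0.
Proof. by apply/eqP => p0; case: valK => v0 _ _ _; move/v0: p0; rewrite vpi. Qed.
Let l10 : l1 != 0. Proof. exact: expf_neq0. Qed.
Let l20 : l2 != 0. Proof. exact: expf_neq0. Qed.
Let l30 : l3 != 0. Proof. exact: expf_neq0. Qed.
Let Rpi n : R (pi ^+ n).
Proof. by apply: vringX => //; rewrite /val_ring /= vpi lee_fin. Qed.
Let HS : is_submod R H. Proof. by case: HH. Qed.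
Let HA a b : H a -> H b -> H (a + b). Proof. by case: HS => _ hyp _; exact: hyp. Qed.
Let HZ c a : R c -> H a -> H (c *: a). Proof. by case: HS => _ _; apply. Qed.
Let HM a b : H a -> H b -> H (a * b). Proof. by case: HH => _ _; apply. Qed.
Let H1 : H 1. Proof. by case: HH. Qed.
Let HB a b : H a -> H b -> H (a - b). Proof. exact: (submodB valK HS). Qed.
Let HX a n : H a -> H (a ^+ n). Proof. by move=> Ha; exact: (subalgX n HH Ha). Qed.

Let chi_gen : [/\ chi1 g1 = 1, chi2 g1 = 0 & chi3 g1 = 0] /\
  [/\ chi1 g2 = 0, chi2 g2 = 1 & chi3 g2 = 0] /\
  [/\ chi1 g3 = 0, chi2 g3 = 0 & chi3 g3 = 1].
Proof.
have := (chiE 1 0 0, chiE 0 1 0, chiE 0 0 1); rewrite /monom !mulg1 !mul1g.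
by move=> [[[-> -> ->] [-> -> ->]] [-> -> ->]].
Qed.

Lemma chi3_nat g : exists k, l3 * chi3 g = k%:R * l3.
Proof.
by have [[[a b] c] <-] := monomP g; have [_ _ /= ->] := chiE a b c; exists c; rewrite mulrC.
Qed.

Lemma chi2_nat g : exists k, l2 * chi2 g = k%:R * l2.
Proof.
by have [[[a b] c] <-] := monomP g; have [_ /= -> _] := chiE a b c; exists b; rewrite mulrC.
Qed.

Lemma chi1_nat g : exists k, l1 * chi1 g = k%:R * l1.
Proof.
by have [[[a b] c] <-] := monomP g; have [/= -> _ _] := chiE a b c; exists a; rewrite mulrC.
Qed.

Lemma chi_eq0 g : chi1 g = 0 -> chi2 g = 0 -> chi3 g = 0 -> g = 1%g.
Proof.
have [[[a b] c] <-] := monomP g; have [/= -> -> ->] := chiE a b c.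
move=> /eqP; rewrite -(dvdn_pcharf charK) => /dvdnP[a' ->].
move=> /eqP; rewrite -(dvdn_pcharf charK) => /dvdnP[b' ->].
move=> /eqP; rewrite -(dvdn_pcharf charK) => /dvdnP[c' ->].
have expp (x : gT) n : (x ^+ (n * p) = 1)%g.
  have [_ xp] := abelemP pr_p abelG; rewrite mulnC expgM xp ?inE //; exact: expg1n.
by rewrite /monom !expp !mulg1.
Qed.

Lemma D3_eq0 a : D3 a = 0 <-> (forall g, a g != 0 -> chi3 g = 0).
Proof.
rewrite gder_eq0; split=> E g /E; last by move=> ->; rewrite mulr0.
by move/eqP; rewrite mulf_eq0 (negPf l30) => /eqP.
Qed.

Lemma l3chi3M : additive_char (fun g => l3 * chi3 g).
Proof. by move=> g h; rewrite chi3M mulrDr. Qed.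

Let D3M a b : D3 (a * b) = D3 a * b + a * D3 b.
Proof. by apply: gderM; exact: l3chi3M. Qed.

Lemma aug1_exp (a : B) : aug a = 1 -> a ^+ p = 1.
Proof. by move=> a1; rewrite (cgalg_pow_p _ charK abelG) a1 expr1n scale1r. Qed.

Let augx1 : aug x1 = 1. Proof. by rewrite x1G aug_gr. Qed.
Let augx2 : aug x2 = 1.
Proof.
rewrite x2G rmorphM /= aug_gr mul1r; apply: (texp_aug charK) => //; exact: augZ.
Qed.

Lemma x1E : x1 = 1 + l1 *: t1.
Proof. by rewrite /t1 /divpi scalerA divff // scale1r addrC subrK. Qed.
Lemma x2E : x2 = 1 + l2 *: t2.
Proof. by rewrite /t2 /divpi scalerA divff // scale1r addrC subrK. Qed.

Let Ht1 : H t1. Proof. by apply: (proj1 (iffRL (kerH _) _)); apply: mem_alg_gen; left. Qed.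
Let Ht2 : H t2. Proof. by apply: (proj1 (iffRL (kerH _) _)); apply: mem_alg_gen; right. Qed.
Let D3t1 : D3 t1 = 0. Proof. by apply: (proj2 (iffRL (kerH _) _)); apply: mem_alg_gen; left. Qed.
Let D3t2 : D3 t2 = 0. Proof. by apply: (proj2 (iffRL (kerH _) _)); apply: mem_alg_gen; right. Qed.
Let D3H a : H a -> H (D3 a). Proof. by move=> Ha; apply: derH. Qed.

Lemma aug_divpi i (x : B) : aug x = 1 -> aug (divpi pi i x) = 0.
Proof. by move=> x0; rewrite /divpi augZ rmorphB rmorph1 /= x0 subrr mulr0. Qed.

Let fall3 a : shifts D3 (fun j => j%:R * l3) p a = 0.
Proof. by apply: (fall_gder0 charK) => g _; exact: chi3_nat. Qed.

(** The constants of [D_3] in [H] are the first term of the sequence, so that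
    [ascent] applies with [X = 1 + l3 T]. *)
Lemma generated_by_lift T : H T -> aug T = 0 -> D3 T = 1 + l3 *: T ->
  H = alg_gen R [set t1; t2; T]%classic.
Proof.
move=> HT T0 DT; pose X := 1 + l3 *: T; set M := alg_gen R _.
have MM : is_subalg R M := alg_gen_subalg R _.
have [[M0 MA MZ] M1 MMu] := MM.
have MT : M T by apply: mem_alg_gen; right.
have Xp : X ^+ p = 1.
  by apply: aug1_exp; rewrite rmorphD rmorph1 /= augZ T0 mulr0 addr0.
have DX : D3 X = l3 *: X.
  by rewrite linearD linearZ /= (der1 D3M) add0r DT.
have TE : l3^-1 *: (X - 1) = T by rewrite /X addrC addKr scalerA mulVf // scale1r.
have MH : (M `<=` H)%classic by apply: (alg_gen_min HH) => y [[->|->]|->].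
apply/seteqP; split=> // x Hx.
apply: (ascent charK valK D3M (Rpi i3) l30 DX Xp HH MM MH D3H _ _ _ Hx (fall3 x)).
- apply: (alg_gen_der D3M) => y [[->|->]|->].
  + by rewrite /= D3t1.
  + by rewrite /= D3t2.
  + rewrite /= DT; apply: (MA) => //; exact: (MZ _ _ (Rpi i3) MT).
- by rewrite -[pi ^- i3]/(l3^-1) TE.
- move=> e He De; apply: (alg_gen_min MM _ (iffLR (kerH e) (conj He De))).
  by move=> y [->|->]; apply: mem_alg_gen; left; [left|right].
Qed.


(** On [K[N]] the two derivations act like the partial derivatives in the
    generators [t1] and [t2] of the first term.  [descent] along [t2], then along
    [t1], takes [w] modulo [l3 H] to an element on which all of [chi1], [chi2],
    [chi3] vanish, that is, to a scalar. *)
Lemma near_scalar (f1 f2 : gT -> K) w :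
    additive_char f1 -> additive_char f2 ->
    (forall a, H a -> H (gder f1 a)) -> (forall a, H a -> H (gder f2 a)) ->
    (forall g, chi3 g = 0 -> f2 g = l2 * chi2 g) ->
    (forall g, chi3 g = 0 -> chi2 g = 0 -> f1 g = l1 * chi1 g) ->
    gder f2 x2 = l2 *: x2 ->
    H w -> D3 w = 0 ->
    (exists2 h, H h & gder f1 w = l3 *: h) -> (exists2 h, H h & gder f2 w = l3 *: h) ->
  exists2 h, H h & w = (aug w)%:A + l3 *: h.
Proof.
move=> f1M f2M f1H f2H f2E f1E D2x2 Hw D3w D1w D2w.
pose J : set B := [set a | exists2 h, H h & a = l3 *: h]%classic.
have J0 : J 0 by exists 0; [case: HS | rewrite scaler0].
have JA a b : J a -> J b -> J (a + b).
  by move=> [x Hx ->] [y Hy ->]; exists (x + y); [exact: HA | rewrite scalerDr].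
have JZ c a : R c -> J a -> J (c *: a).
  move=> Rc [x Hx ->]; exists (c *: x); first exact: HZ.
  by rewrite !scalerA mulrC.
have JS : is_submod R J by split.
have Jder f a : (forall a, H a -> H (gder (abG := abG) f a)) -> J a -> J (gder f a).
  by move=> fH [x Hx ->]; exists (gder f x); [exact: fH | rewrite linearZ].
have JM a b : H a -> J b -> J (a * b).
  by move=> Ha [x Hx ->]; exists (a * x); [exact: HM | rewrite scalerAr].
pose J1 : set B := [set a | J a /\ D3 a = 0]%classic.
have J1S : is_submod R J1.
  split=> [|a b [Ja a0] [Jb b0]|c a Rc [Ja a0]]; split => /=; rewrite ?linear0 //.
  - exact: JA.
  - by rewrite linearD /= a0 b0 addr0.
  - exact: JZ.
  - by rewrite linearZ /= a0 scaler0.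
have D2M a b : gder (abG := abG) f2 (a * b) = gder f2 a * b + a * gder f2 b by exact: gderM.
have D1M a b : gder (abG := abG) f1 (a * b) = gder f1 a * b + a * gder f1 b by exact: gderM.
have [||||e D2e [Jwe D3we]] :=
    descent charK valK D2M (Rpi i2) l20 D2x2 (aug1_exp augx2) (J := J1) (y := w) J1S.
- by move=> a [Ja a0]; split; [exact: Jder | rewrite /= gderC a0 linear0].
- move=> a [Ja a0]; split; first exact: JM.
  by rewrite /= D3M a0 mulr0 addr0 -/t2 D3t2 mul0r.
- apply: (fall_gder0 charK) => g wg.
  by rewrite f2E; [exact: chi2_nat | exact: (iffLR (D3_eq0 w) D3w)].
- by split; [| rewrite /= gderC D3w linear0].
have D3e : D3 e = 0.
  by have := D3we; rewrite linearB /= D3w sub0r => /eqP; rewrite oppr_eq0 => /eqP.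
pose J2 : set B := [set a | J1 a /\ gder f2 a = 0]%classic.
have J2S : is_submod R J2.
  have [J10 J1A J1Z] := J1S.
  split=> [|a b [Ja a0] [Jb b0]|c a Rc [Ja a0]]; split => /=; rewrite ?linear0 //.
  - exact: J1A.
  - by rewrite linearD /= a0 b0 addr0.
  - exact: J1Z.
  - by rewrite linearZ /= a0 scaler0.
have [[c11 c12 c13] _] := chi_gen.
have D1x1 : gder f1 x1 = l1 *: x1 by rewrite x1G gder_gr f1E // c11 mulr1.
have D2t1 : gder f2 t1 = 0.
  rewrite /t1 /divpi linearZ linearB /= (der1 D2M) subr0 x1G gder_gr f2E // c12 mulr0.
  by rewrite scale0r scaler0.
have e_supp g : e g != 0 -> chi3 g = 0 /\ chi2 g = 0.
  move=> eg; have z3 := iffLR (D3_eq0 e) D3e g eg; split=> //.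
  have := iffLR (gder_eq0 f2 e) D2e g eg; rewrite f2E // => /eqP.
  by rewrite mulf_eq0 (negPf l20) => /eqP.
have [||||e' D1e' [[Jee D3ee] D2ee]] :=
    descent charK valK D1M (Rpi i1) l10 D1x1 (aug1_exp augx1) (J := J2) (y := e) J2S.
- move=> a [[Ja a3] a2]; split; first split; first exact: Jder.
    by rewrite /= gderC a3 linear0.
  by rewrite /= gderC a2 linear0.
- move=> a [[Ja a3] a2]; rewrite -/t1; split; first split; first exact: JM.
    by rewrite D3M a3 mulr0 addr0 D3t1 mul0r.
  by rewrite D2M a2 mulr0 addr0 D2t1 mul0r.
- by apply: (fall_gder0 charK) => g /e_supp[z3 z2]; rewrite f1E //; exact: chi1_nat.
- split; last by rewrite /= gderC D2e linear0.
  split; last by rewrite /= gderC D3e linear0.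
  rewrite -[e](subKr w) linearB; apply: (JA) => //.
  by apply: (submodN valK JS); exact: Jder.
have [c e'E] : exists c, e' = c%:A.
  exists (e' 1%g); rewrite [LHS]grBE (bigD1 1%g) //= big1 ?addr0 => [//|g g1'].
  have [->|e'g] := eqVneq (e' g) 0; first by rewrite scale0r.
  have e'2 : gder f2 e' = 0 by have /eqP := D2ee; rewrite linearB /= D2e sub0r oppr_eq0 => /eqP.
  have e'3 : D3 e' = 0 by have /eqP := D3ee; rewrite linearB /= D3e sub0r oppr_eq0 => /eqP.
  have z3 := iffLR (D3_eq0 e') e'3 g e'g.
  have := iffLR (gder_eq0 f2 e') e'2 g e'g; rewrite f2E // => /eqP.
  rewrite mulf_eq0 (negPf l20) /= => /eqP z2.
  have := iffLR (gder_eq0 f1 e') D1e' g e'g; rewrite f1E // => /eqP.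
  rewrite mulf_eq0 (negPf l10) /= => /eqP z1.
  by rewrite (chi_eq0 z1 z2 z3) eqxx in g1'.
have [h Hh wE] : J (w - e').
  by rewrite -[w](subrK e) -addrA; apply: JA.
have augw : aug w = c + l3 * aug h.
  have := congr1 (@aug K gT abG) wE; rewrite rmorphB /= augZ e'E augZ rmorph1 mulr1.
  by move/eqP; rewrite subr_eq addrC => /eqP.
exists (h - (aug h)%:A); first by apply: HB => //; apply: HZ => //; exact: augH.
rewrite -[LHS](subrK e') wE e'E augw scalerDl scalerBr scalerA.
by rewrite addrC -addrA; congr (_ + _); rewrite addrC subrK.
Qed.

Variable W : B.
Hypotheses (HW : H W) (augW : aug W = 0) (D3W : D3 W = 1 + l3 *: W).
Let X := 1 + l3 *: W.
Let u := G g3^-1%g * X.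

Let Hu : H u.
Proof. by apply: HM; [exact: GH | apply: HA => //; exact: (HZ (Rpi i3) HW)]. Qed.

Let gK : G g3 * G g3^-1%g = 1. Proof. by rewrite -grBM mulgV grB1. Qed.

Let XE : X = G g3 * u. Proof. by rewrite /u mulrA gK mul1r. Qed.

Let augu : aug u = 1.
Proof. by rewrite /u rmorphM /= aug_gr mul1r rmorphD rmorph1 /= augZ augW mulr0 addr0. Qed.

Let D3u : D3 u = 0.
Proof.
have [_ [_ [_ _ c33]]] := chi_gen.
have cV : chi3 g3^-1%g = - chi3 g3.
  by apply/eqP; rewrite -addr_eq0 -chi3M mulVg additive_char1.
rewrite /u D3M gder_gr cV c33 /X linearD linearZ /= (der1 D3M) add0r D3W.
by rewrite mulrN1 scaleNr mulNr -scalerAl -scalerAr addNr.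
Qed.

(** The value of [f] at [g3] is chosen such that [counit (D_f W) = 0], hence [f] is
    integral on the generators [t1], [t2], [W] of [H] and [D_f] preserves [H].  The
    equation is the image under [D_f] of [g3 u = 1 + l3 W]. *)
Lemma log_der_unit (f : gT -> K) : additive_char f ->
    R (aug (gder (abG := abG) f t1)) -> R (aug (gder (abG := abG) f t2)) ->
    f g3 = - aug (gder f u) ->
  [/\ forall a, H a -> H (gder f a), R (aug (gder f u))
    & exists2 r, H r & gder f u = aug (gder f u) *: u + l3 *: r].
Proof.
move=> fM ft1 ft2 fg3; set a := aug (gder f u).
have fDM b c : gder (abG := abG) f (b * c) = gder f b * c + b * gder f c by exact: gderM.
have fX : gder f X = l3 *: gder f W.
  by rewrite linearD linearZ /= (der1 fDM) add0r.
have fXu : gder f X = - a *: X + G g3 * gder f u.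
  by rewrite XE fDM gder_gr fg3 -scalerAl.
have augX : aug X = 1 by rewrite rmorphD rmorph1 /= augZ augW mulr0 addr0.
have fW0 : aug (gder f W) = 0.
  apply: (mulfI l30); rewrite mulr0 -augZ -fX fXu rmorphD rmorphM /= augZ augX aug_gr.
  by rewrite mulr1 mul1r addNr.
have fR b : H b -> R (aug (gder f b)).
  rewrite (generated_by_lift HW augW D3W) => Hb.
  apply: (proj2 (alg_gen_min (integral_subalg valK abG fM) _ Hb)).
  have R0 := vring0 valK.
  move=> y [[->|->]|->]; split=> //=; rewrite ?augW ?fW0 // aug_divpi //.
have fH b : H b -> H (gder f b) by exact: derH.
split=> //; first exact: fR.
exists (G g3^-1%g * gder f W); first by apply: HM => //; exact: fH.
rewrite [l3 *: _]scalerAr -fX fXu mulrDr [_ * (G g3 * _)]mulrCA mulrA gK mul1r.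
by rewrite -scalerAr -/u scaleNr addrA subrr add0r.
Qed.

Lemma presentation : exists alpha beta : K,
  [/\ H = alg_gen R [set t1; t2;
           divpi pi i3 (G g3 * texp p x1 alpha * texp p x2 beta)]%classic,
      R (pi ^+ (p * i1) * (wp p alpha + wp p mu * beta) / l3)
    & R (pi ^+ (p * i2) * wp p beta / l3)].
Proof.
have [[c11 c12 c13] [[c21 c22 c23] [c31 c32 c33]]] := chi_gen.
pose f10 g := l1 * chi1 g - l1 * mu * chi2 g; pose f20 g := l2 * chi2 g.
pose a1 := aug (gder (abG := abG) f10 u); pose a2 := aug (gder (abG := abG) f20 u).
pose f1 g := f10 g - a1 * chi3 g; pose f2 g := f20 g - a2 * chi3 g.
have f1M : additive_char f1.
  by move=> g h; rewrite /f1 /f10 chi1M chi2M chi3M; ring.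
have f2M : additive_char f2.
  by move=> g h; rewrite /f2 /f20 chi2M chi3M; ring.
have u_supp := iffLR (D3_eq0 u) D3u.
have f1u : gder f1 u = gder f10 u.
  by apply: eq_gder => g /u_supp z3; rewrite /f1 z3 mulr0 subr0.
have f2u : gder f2 u = gder f20 u.
  by apply: eq_gder => g /u_supp z3; rewrite /f2 z3 mulr0 subr0.
have D1M a b : gder (abG := abG) f1 (a * b) = gder f1 a * b + a * gder f1 b by exact: gderM.
have D2M a b : gder (abG := abG) f2 (a * b) = gder f2 a * b + a * gder f2 b by exact: gderM.
set z1 : B := x1 - 1; set z2 : B := x2 - 1.
have D1x1 : gder f1 x1 = l1 *: x1.
  by rewrite x1G gder_gr /f1 /f10 c11 c12 c13 !mulr0 !subr0 mulr1.
have D2x1 : gder f2 x1 = 0.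
  by rewrite x1G gder_gr /f2 /f20 c12 c13 !mulr0 subr0 scale0r.
have D1x1' : gder f1 x1 = l1%:A * x1 by rewrite mulr_algl.
have D2x1' : gder f2 x1 = 0 * x1 by rewrite mul0r.
have D2x2 : gder f2 x2 = l2 *: x2.
  rewrite {1}x2G D2M (der_texp charK _ D2M D2x1') mul0r mulr0 addr0 gder_gr /f2 /f20 c22 c23.
  by rewrite mulr1 mulr0 subr0 -scalerAl -x2G.
have z1p : z1 ^+ p = 0.
  by rewrite (cgalg_pow_p _ charK abelG) rmorphB rmorph1 /= augx1 subrr expr0n gtn_eqF ?prime_gt0 // scale0r.
have D1x2 : gder f1 x2 = (l1 * wp p mu) *: (z1 ^+ p.-1 * x2).
  rewrite x2G D1M (der_texp charK _ D1M D1x1') gder_gr /f1 /f10 c21 c22 c23 -/z1.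
  rewrite mulr_algl scalerDr !scalerA mulr1 !mulr0 sub0r subr0 mulrDr.
  rewrite [z1 ^+ _ * _]mulrCA (texp_mul_top charK _ z1p) scaleNr mulNr.
  by rewrite -!scalerAl -!scalerAr addrA addNr add0r.
have D2x2' : gder f2 x2 = l2%:A * x2 by rewrite mulr_algl.
have D1x2' : gder f1 x2 = ((l1 * wp p mu) *: z1 ^+ p.-1) * x2 by rewrite -scalerAl.
have augz1 : aug z1 = 0 by rewrite rmorphB rmorph1 /= augx1 subrr.
have p1_gt0 : (0 < p.-1)%N by rewrite -ltnS prednK ?prime_gt0.
have dt (f : gT -> K) i (x : B) : additive_char f ->
    gder f (divpi pi i x) = pi ^- i *: gder f x.
  move=> fM; have fDM b c : gder (abG := abG) f (b * c) = gder f b * c + b * gder f c by exact: gderM.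
  by rewrite linearZ linearB /= (der1 fDM) subr0.
have R0 := vring0 valK; have R1 := vring1 valK.
have [f1H Ra1 [r1 Hr1 D1u]] : [/\ forall a, H a -> H (gder f1 a), R (aug (gder f1 u))
    & exists2 r, H r & gder f1 u = aug (gder f1 u) *: u + l3 *: r].
  apply: log_der_unit => //.
  - by rewrite dt // D1x1 !augZ augx1 mulr1 mulVf.
  - by rewrite dt // D1x2 !augZ rmorphM rmorphXn /= augz1 expr0n gtn_eqF // mul0r !mulr0.
  - by rewrite f1u /f1 /f10 c31 c32 c33 !mulr0 subr0 sub0r mulr1.
have [f2H Ra2 [r2 Hr2 D2u]] : [/\ forall a, H a -> H (gder f2 a), R (aug (gder f2 u))
    & exists2 r, H r & gder f2 u = aug (gder f2 u) *: u + l3 *: r].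
  apply: log_der_unit => //.
  - by rewrite dt // D2x1 scaler0 rmorph0.
  - by rewrite dt // D2x2 !augZ augx2 mulr1 mulVf.
  - by rewrite f2u /f2 /f20 c32 c33 !mulr0 sub0r mulr1.
rewrite f1u -/a1 in Ra1; rewrite f2u -/a2 in Ra2.
rewrite [in aug _]f1u -/a1 in D1u; rewrite [in aug _]f2u -/a2 in D2u.
pose alpha := a1 / l1; pose beta := a2 / l2.
have a1E : a1 = l1 * alpha by rewrite /alpha mulrC mulfVK.
have a2E : a2 = l2 * beta by rewrite /beta mulrC mulfVK.
have Frob1 g : chi1 g ^+ p = chi1 g.
  have [[[a b] c] <-] := monomP g; have [/= -> _ _] := chiE a b c.
  by rewrite -(pFrobenius_autE charK) pFrobenius_aut_nat.
have Frob2 g : chi2 g ^+ p = chi2 g.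
  have [[[a b] c] <-] := monomP g; have [_ /= -> _] := chiE a b c.
  by rewrite -(pFrobenius_autE charK) pFrobenius_aut_nat.
have powS (l : K) : l ^+ p = l * l ^+ p.-1 by rewrite -exprS prednK ?prime_gt0.
(* The p-th power of [D_1] is a combination of [D_1] and [D_2] on [K[N]]: compare
   the augmentations of both sides applied to [u]. *)
have [s1 Hs1 ps1] : exists2 s, H s & a1 ^+ p = l1 ^+ p.-1 * a1 - omega * a2 - l3 * aug s.
  have [s Hs] := iter_der_approx valK HH Ra1 p f1H Hu Hr1 D1u.
  rewrite iter_gder (eq_gder (f' := fun g => l1 ^+ p.-1 * f10 g - omega * f20 g)); last first.
    move=> g /u_supp z3; rewrite /f1 z3 mulr0 subr0 /f10 /f20 -(pFrobenius_autE charK) rmorphB /=.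
    rewrite !pFrobenius_autE !exprMn Frob1 Frob2 /omega mulnC exprM -/l1.
    by rewrite /wp !(powS l1); field.
  have -> : gder (fun g => l1 ^+ p.-1 * f10 g - omega * f20 g) u =
      l1 ^+ p.-1 *: gder f10 u - omega *: gder f20 u.
    by apply/ffunP => g; rewrite !ffunE -![_ *: _]/(_ * _); ring.
  move/(congr1 (@aug K gT abG)); rewrite rmorphB rmorphD /= !augZ augu mulr1 -/a1 -/a2 => E.
  by exists s => //; rewrite E addrK.
have [s2 Hs2 ps2] : exists2 s, H s & a2 ^+ p = l2 ^+ p.-1 * a2 - l3 * aug s.
  have [s Hs] := iter_der_approx valK HH Ra2 p f2H Hu Hr2 D2u.
  rewrite iter_gder (eq_gder (f' := fun g => l2 ^+ p.-1 * f20 g)); last first.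
    move=> g /u_supp z3; rewrite /f2 z3 mulr0 subr0 /f20 !exprMn Frob2.
    by rewrite (powS l2); ring.
  have -> : gder (fun g => l2 ^+ p.-1 * f20 g) u = l2 ^+ p.-1 *: gder f20 u.
    by apply/ffunP => g; rewrite !ffunE -[RHS]/(_ * (_ * _)) mulrA.
  move/(congr1 (@aug K gT abG)); rewrite rmorphD /= !augZ augu mulr1 -/a2 => E.
  by exists s => //; rewrite E addrK.
pose e1 := pi ^+ (p * i1) * (wp p alpha + wp p mu * beta) / l3.
pose e2 := pi ^+ (p * i2) * wp p beta / l3.
have e1E : e1 = - aug s1.
  apply: (mulIf l30); rewrite /e1 mulfVK // mulNr [aug s1 * _]mulrC.
  have -> : - (l3 * aug s1) = a1 ^+ p - l1 ^+ p.-1 * a1 + omega * a2 by rewrite ps1; ring.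
  rewrite a1E a2E /omega mulnC exprM -/l1 /wp !exprMn.
  by rewrite !(powS l1); field.
have e2E : e2 = - aug s2.
  apply: (mulIf l30); rewrite /e2 mulfVK // mulNr [aug s2 * _]mulrC.
  have -> : - (l3 * aug s2) = a2 ^+ p - l2 ^+ p.-1 * a2 by rewrite ps2; ring.
  by rewrite a2E mulnC exprM -/l2 /wp !exprMn !(powS l2); ring.
have Re1 : R e1 by rewrite e1E; apply: (vringN valK); exact: augH.
have Re2 : R e2 by rewrite e2E; apply: (vringN valK); exact: augH.
exists alpha, beta; split=> //.
pose v1 := texp p x1 alpha; pose v2 := texp p x2 beta; pose vv := v1 * v2.
have Hv1 : H v1.
  by rewrite /v1 x1E; apply: (texp_integral charK valK HH Ht1 (Rpi i1)); rewrite -/l1 -a1E.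
have Hv2 : H v2.
  by rewrite /v2 x2E; apply: (texp_integral charK valK HH Ht2 (Rpi i2)); rewrite -/l2 -a2E.
have Hvv : H vv by exact: HM.
have augvv : aug vv = 1.
  rewrite rmorphM /= (texp_aug charK _ _ augx1) ?(texp_aug charK _ _ augx2) ?mulr1 //; exact: augZ.
have z1E : z1 ^+ p.-1 = l1 ^+ p.-1 *: t1 ^+ p.-1 by rewrite -exprZn -[l1 *: t1](addKr 1) -x1E addrC.
have z2E : z2 ^+ p.-1 = l2 ^+ p.-1 *: t2 ^+ p.-1 by rewrite -exprZn -[l2 *: t2](addKr 1) -x2E addrC.
have D2vv : gder f2 vv = a2 *: vv + l3 *: (e2 *: (v1 * t2 ^+ p.-1)).
  rewrite (der_texp_mulr charK _ _ D2M D2x1 D2x2) -/z2 z2E -scalerAr !scalerA a2E.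
  by congr (_ + _ *: _); rewrite /e2 mulnC exprM -/l2 (powS l2); field.
have D1vv : gder f1 vv = a1 *: vv +
    l3 *: (t1 ^+ p.-1 * (e1 *: v2 + (omega * e2) *: t2 ^+ p.-1)).
  rewrite (der_texp_mull charK _ _ D1M D1x1 D1x2' z1p) -/z1 -/z2 -/v2 z1E z2E.
  rewrite -(scalerAl (l1 ^+ p.-1)) [in RHS]a1E -/v1 -/vv; congr (_ + _).
  rewrite (scalerAr (l1 ^+ p.-1)) (scalerAr l3) !scalerDr !scalerA.
  congr (_ * (_ *: _ + _ *: _)).
    by rewrite /e1 mulnC exprM -/l1 (powS l1); field.
  by rewrite /e2 /omega !(mulnC p) !exprM -/l1 -/l2 (powS l1) (powS l2); field; rewrite l20 l30.
have e1H : H (t1 ^+ p.-1 * (e1 *: v2 + (omega * e2) *: t2 ^+ p.-1)).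
  apply: HM; first exact: HX.
  by apply: HA; apply: HZ => //; [exact: vringM | exact: HX].
have e2H : H (e2 *: (v1 * t2 ^+ p.-1)).
  by apply: HZ => //; apply: HM => //; exact: HX.
have D1w := der_quot_approx charK valK D1M HH Hu Hvv Hr1 e1H D1u D1vv.
have D2w := der_quot_approx charK valK D2M HH Hu Hvv Hr2 e2H D2u D2vv.
have D3x1 : D3 x1 = 0 * x1 by rewrite x1E linearD linearZ /= (der1 D3M) D3t1 scaler0 mul0r addr0.
have D3x2 : D3 x2 = 0 * x2 by rewrite x2E linearD linearZ /= (der1 D3M) D3t2 scaler0 mul0r addr0.
have D3vv : D3 vv = 0.
  by rewrite D3M (der_texp charK _ D3M D3x1) (der_texp charK _ D3M D3x2) !mul0r mulr0 addr0.
(* As [vv^p = 1], this is [u / vv]. *)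
set w := u * vv ^+ p.-1 in D1w D2w.
have Hw : H w by apply: HM => //; exact: HX.
have D3w : D3 w = 0 by rewrite D3M (der_exp D3M) /= D3vv mulr0 mul0rn mulr0 D3u mul0r addr0.
have augw : aug w = 1 by rewrite rmorphM rmorphXn /= augvv expr1n augu mulr1.
have f2E g : chi3 g = 0 -> f2 g = l2 * chi2 g.
  by move=> c3; rewrite /f2 /f20 c3 mulr0 subr0.
have f1E g : chi3 g = 0 -> chi2 g = 0 -> f1 g = l1 * chi1 g.
  by move=> c3 c2; rewrite /f1 /f10 c3 c2 !mulr0 !subr0.
have [h Hh] := near_scalar f1M f2M f1H f2H f2E f1E D2x2 Hw D3w D1w D2w.
rewrite augw scale1r => wE.
have uE : u = vv + l3 *: (h * vv).
  have -> : u = w * vv by rewrite /w -mulrA -exprSr prednK ?prime_gt0 // (aug1_exp augvv) mulr1.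
  by rewrite wE mulrDl mul1r -scalerAl.
pose Y := G g3 * vv; have YE : G g3 * v1 * v2 = Y by rewrite -mulrA.
rewrite YE.
have augY : aug Y = 1 by rewrite rmorphM /= aug_gr augvv mulr1.
have TE : divpi pi i3 Y = W - G g3 * (h * vv).
  have -> : Y = 1 + l3 *: (W - G g3 * (h * vv)).
    by rewrite scalerBr addrA -/X XE uE mulrDr -scalerAr addrK.
  by rewrite /divpi addrC addKr scalerA mulVf ?scale1r.
have l3T : l3 *: divpi pi i3 Y = Y - 1 by rewrite /divpi scalerA divff // scale1r.
apply: generated_by_lift.
- by rewrite TE; apply: HB => //; apply: HM => //; exact: HM.
- exact: aug_divpi.
- have -> : 1 + l3 *: divpi pi i3 Y = Y by rewrite l3T addrC subrK.
  rewrite /divpi linearZ linearB /= (der1 D3M) subr0 /Y D3M D3vv mulr0 addr0.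
  by rewrite gder_gr c33 mulr1 -scalerAl scalerA mulVf ?scale1r.
Qed.

End HopfOrderInRankThree.

Theorem proposition5p8 (p : nat) (K : fieldType) (v : K -> \bar int) (pi : K)
    (gT : finGroupType) (g1 g2 g3 : gT) (H : set (galg K gT))
    (i1 i2 i3 : nat) (mu : K)
    (charK : p \in [pchar K])
    (valK : discrete_valuation v) (complK : val_complete v) (vpi : v pi = 1%:E)
    (abelG : p.-abelem%g [set: gT]%SET) (cardG : #|[set: gT]%SET| = (p ^ 3)%N)
    (genG : <<[set g1; g2; g3]%SET>>%g = [set: gT]%SET) :
  let N : {set gT} := <<[set g1; g2]%SET>>%g in
  let x1 := gr K g1 in
  let x2 := gr K g2 * texp p x1 mu in
  let x3 := gr K g3 in
  Hopf_order v H ->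
  ((i2%:Z - p%:Z * i1%:Z)%R%:E <= v (wp p mu))%E ->
  (H `&` galg_sub K N)%classic =
    alg_gen (val_ring v) [set divpi pi i1 x1; divpi pi i2 x2]%classic ->
  (galg_map (coset N) @` H)%classic =
    alg_gen (val_ring v) [set divpi pi i3 (gr K (coset N g3))]%classic ->
  ((i3%:Z - i1%:Z)%R%:E <= v mu)%E ->
  (i3 <= i2)%N ->
  exists alpha beta : K,
    [/\ H = alg_gen (val_ring v)
          [set divpi pi i1 x1; divpi pi i2 x2;
               divpi pi i3 (x3 * texp p x1 alpha * texp p x2 beta)]%classic,
        ((i3%:Z - p%:Z * i1%:Z)%R%:E <= v (wp p alpha + wp p mu * beta)%R)%E
      & ((i3%:Z - p%:Z * i2%:Z)%R%:E <= v (wp p beta))%E].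
Proof.
move=> N x1 x2 x3 [HH fgH spanH [comH augH _]] wpmu HN Hbar _ _.
have abG : abelian [set: gT] := abelem_abelian abelG.
have pr_p := pcharf_prime charK.
have pi0 : pi != 0 by apply/eqP => p0; case: valK => v0 _ _ _; move/v0: p0; rewrite vpi.
have [chi1 [chi2 [chi3 [chi1M chi2M chi3M chiE]]]] :=
  coordinate_chars pr_p abelG cardG genG charK.
have monomP := monom_onto pr_p abelG genG.
have [HS _ _] := HH.
pose f3 g := pi ^+ i3 * chi3 g.
have f3M : additive_char f3 by move=> g h; rewrite /f3 chi3M mulrDr.
have chi3E : [/\ chi3 g1 = 0, chi3 g2 = 0 & chi3 g3 = 1].
  have := (chiE 1 0 0, chiE 0 1 0, chiE 0 0 1); rewrite /monom !mulg1 !mul1g.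
  by move=> [[[_ _ ->] [_ _ ->]] [_ _ ->]].
have [c31 c32 c33] := chi3E.
have NE g : (g \in N) = (chi3 g == 0).
  apply/idP/idP; last first.
    have [[[a b] c] <-] := monomP g; have [_ _ /= ->] := chiE a b c.
    rewrite -(dvdn_pcharf charK) => /dvdnP[c' ->].
    have [_ xp] := abelemP pr_p abelG.
    rewrite /monom mulnC expgM xp ?inE // expg1n mulg1.
    by rewrite groupM ?groupX ?mem_gen // !inE eqxx ?orbT.
  have gS : group_set [set g | chi3 g == 0]%SET.
    apply/group_setP; split; first by rewrite inE additive_char1.
    by move=> x y; rewrite !inE chi3M => /eqP-> /eqP->; rewrite addr0.
  have : N \subset Group gS.
    by rewrite gen_subG; apply/fintype.subsetP => x; rewrite !inE => /orP[] /eqP->; rewrite ?c31 ?c32.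
  by move=> /fintype.subsetP NS /NS; rewrite inE.
have f3N g : g \in <<[set g1; g2]%SET>>%G -> f3 g = 0.
  by rewrite -/N => gN; rewrite /f3; move: gN; rewrite [_ \in _]NE => /eqP->; rewrite mulr0.
pose fb := coset_char (N := <<[set g1; g2]%SET>>%G) f3.
have fbM : additive_char fb := coset_charM abG f3M f3N.
pose Hb : set (cgalg K abG) := H.
have HHb : is_subalg (val_ring v) Hb by exact: HH.
have HSb : is_submod (val_ring v) Hb by exact: HS.
have derH : forall (f : gT -> K) a,
    (forall b, Hb b -> val_ring v (aug (gder f b))) -> Hb a -> Hb (gder f a).
  by move=> f a; exact: (gder_stable comH HSb).
have GH g : Hb (grB K abG g).
  exact: (grB_mem valK (comH : forall a, Hb a -> _) HSb augH vpi spanH fgH).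
pose abQ := coset_abelian <<[set g1; g2]%SET>>%G abG.
pose gb : cgalg K abQ := grB K abQ (coset N g3).
have Dgb : gder fb gb = pi ^+ i3 *: gb.
  by rewrite /gb gder_gr /fb coset_charE // /f3 c33 mulr1.
have fbDM (b c : cgalg K abQ) : gder fb (b * c) = gder fb b * c + b * gder fb c.
  exact: gderM.
pose tb : cgalg K abQ := divpi pi i3 gb.
have augtb : aug tb = 0.
  by rewrite /tb /divpi augZ rmorphB rmorph1 /= aug_gr subrr mulr0.
have Dtb : aug (gder fb tb) = 1.
  rewrite /tb /divpi linearZ linearB /= (der1 fbDM) subr0 Dgb !augZ aug_gr mulr1.
  by rewrite mulVf // expf_neq0.
have D3R a : Hb a -> val_ring v (aug (gder f3 a)).
  move=> Ha; rewrite -(gder_coset (N := <<[set g1; g2]%SET>>%G) f3M f3N a).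
  have : alg_gen (val_ring v) [set tb]%classic (galg_map (coset N) a : cgalg K abQ).
    have : (galg_map (coset N) @` H)%classic (galg_map (coset N) a) by exists a.
    by rewrite Hbar.
  move/(alg_gen_min (integral_subalg valK abQ fbM)) => [] //.
  move=> _ ->; rewrite /mkset Dtb augtb; split; [exact: vring0|exact: vring1].
have [h Hh hE] : exists2 h : cgalg K abG, Hb h & galg_map (coset N) h = tb.
  have : (galg_map (coset N) @` H)%classic tb by rewrite Hbar; apply: mem_alg_gen.
  by move=> [h Hh hE]; exists h.
have h0 : aug h = 0 by rewrite -(aug_coset <<[set g1; g2]%SET>>%G h) [galg_map _ _]hE.
have h1 : aug (gder f3 h) = 1.
  by rewrite -(gder_coset (N := <<[set g1; g2]%SET>>%G) f3M f3N h) [galg_map _ _]hE.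
have chi3k g : exists k, f3 g = k%:R * pi ^+ i3.
  have [[[a b] c] <-] := monomP g; have [_ _ /= c3] := chiE a b c.
  by exists c; rewrite /f3 c3 mulrC.
have Rpi : val_ring v (pi ^+ i3).
  by apply: vringX => //; rewrite /val_ring /= vpi lee_fin.
have [W [HW augW D3W]] :=
  eigen_lift charK valK abelG f3M chi3k Rpi HHb (fun a => derH f3 a D3R) Hh h0 h1.
have kerH (a : cgalg K abG) : (Hb a /\ gder f3 a = 0) <->
    alg_gen (val_ring v) [set divpi pi i1 (x1 : cgalg K abG);
                              divpi pi i2 (x2 : cgalg K abG)]%classic a.
  have <- : ((H `&` galg_sub K N)%classic a) <-> 
    alg_gen (val_ring v) [set divpi pi i1 (x1 : cgalg K abG);
                              divpi pi i2 (x2 : cgalg K abG)]%classic a by rewrite HN.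
  rewrite gder_eq0; split=> [[Ha E]|[Ha E]]; split=> // g.
    move=> gN; have [//|/E/eqP] := eqVneq (a g) 0.
    by rewrite /f3 mulf_eq0 expf_eq0 (negPf pi0) andbF -NE (negPf gN).
  move=> ag; apply: f3N; apply/negPn/negP => gN.
  by have := E g gN => a0; rewrite a0 eqxx in ag.
have Romega : val_ring v (pi ^+ (p * i1) * wp p mu / pi ^+ i2).
  by apply/(val_geP valK _ _ _ vpi); rewrite PoszM.
have [alpha [beta [HE e1 e2]]] := presentation charK valK vpi abelG chi1M chi2M chi3M
  chiE monomP Romega (erefl (x1 : cgalg K abG)) (erefl (x2 : cgalg K abG))
  HHb augH derH GH D3R kerH HW augW D3W.
exists alpha, beta; split; first exact: HE.
- by move/(val_geP valK _ _ _ vpi): e1; rewrite PoszM.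
- by move/(val_geP valK _ _ _ vpi): e2; rewrite PoszM.
Qed.
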